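(* Let $n>2$, let $\lambda=(\lambda_1,\ldots,\lambda_n)$ with $\lambda_1\ge\cdots\ge\lambda_n>0$, let $A=\mathrm{diag}(\lambda)$, and suppose $A$ has an intermediate eigenvalue, i.e. there exists $i\in\{2,\ldots,n-1\}$ such that $\lambda_1>\lambda_i>\lambda_n$. Then the rate of convergence $\rho^\ast(\cdot,\lambda)$ of the exact line search gradient descent method applied to $f(x)=\frac12x^TAx$ satisfies $$\operatorname*{ess\,inf}_{x^{(0)}\in\mathbb S^{n-1}}\rho^\ast(x^{(0)},\lambda)=\frac{1-a}{\sqrt{(1+a)^2+Ba}},$$ where $a=\mathrm{cond}(A)^{-1}=\lambda_n/\lambda_1$, $B=\dfrac{4(1+\delta^2)}{1-\delta^2}$, and $$\delta=\min_{i:\ \lambda_1>\lambda_i>\lambda_n}\frac{|\lambda_i-(\lambda_1+\lambda_n)/2|}{(\lambda_1-\lambda_n)/2}.$$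
   Context: For $A=\mathrm{diag}(\lambda)$, the exact line search gradient descent method for $f(x)=\frac12x^TAx$ is the iteration $x^{(k+1)}=\mathsf{OGD}(x^{(k)})$, where $\mathsf{OGD}(x)=x-\frac{x^TA^2x}{x^TA^3x}Ax$ for $x\ne0$ and $\mathsf{OGD}(0)=0$. The one-step shrinking factor is, for $x\ne0$, $$\rho(x,\lambda)=\sqrt{1-\frac{(x^TA^2x)^2}{(x^TAx)(x^TA^3x)}},$$ with the convention $\rho(0,\lambda)=0$. For $x^{(0)}\neq0$ the rate of convergence is $$\rho^\ast(x^{(0)},\lambda)=\limsup_{k\to\infty}\Big[\prod_{j=0}^{k-1}\rho(\mathsf{OGD}^j(x^{(0)}),\lambda)\Big]^{1/k}.$$ The essential infimum is taken with respect to the uniform probability measure on the unit sphere $\mathbb S^{n-1}\subset\mathbb R^n$. *)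

(* Defs.v *)
From HB Require Import structures.
From mathcomp Require Import all_boot all_order all_algebra.
From mathcomp Require Import all_classical all_reals all_analysis.
From mathcomp Require Import measurable_realfun ess_sup_inf.
Set Implicit Arguments.
Unset Strict Implicit.
Unset Printing Implicit Defensive.
Import Order.TTheory GRing.Theory Num.Theory numFieldNormedType.Exports.
Local Open Scope classical_set_scope.
Local Open Scope ring_scope.

(* The library has neither Lebesgue measure in dimension [n] nor surface
   measure.  Here R^n is [n.-tuple] with its product sigma-algebra, its Lebesgue
   measure is an iterated product [\x], and the uniform probability measure of
   the unit sphere is the normalized cone measure
     E |-> vol {x in B | x / |x| in E} / vol B,
   B being the unit ball without its center.  It is a measure on the ambient
   R^n, of total mass 1 ([sphere_measure_setT]) and carried by the sphere
   ([sphere_measure_sphere]). *)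
Notation Rtuple R n := (n.-tuple (measurableTypeR R)).

Section lebesgue_tuple.
Context {R : realType}.
Local Open Scope ereal_scope.

Definition tuple_cons n (p : measurableTypeR R * Rtuple R n) : Rtuple R n.+1 :=
  [tuple of p.1 :: p.2].

Lemma measurable_tuple_cons n : measurable_fun [set: _] (@tuple_cons n).
Proof. exact: measurable_cons. Qed.

Section step.
Variables (n : nat) (mu : {sigma_finite_measure set (Rtuple R n) -> \bar R}).

Definition lebesgue_cons : set (Rtuple R n.+1) -> \bar R :=
  pushforward (lebesgue_measure \x mu) (@tuple_cons n).

Let mcons : measurable_fun [set: _] (@tuple_cons n).
Proof. exact: measurable_tuple_cons. Qed.

Let lebesgue_cons0 : lebesgue_cons set0 = 0.
Proof. by rewrite /lebesgue_cons /pushforward preimage_set0 measure0. Qed.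

Let lebesgue_cons_ge0 A : 0 <= lebesgue_cons A.
Proof. exact: measure_ge0. Qed.

Let lebesgue_cons_sigma_additive : semi_sigma_additive lebesgue_cons.
Proof. exact: measure_semi_sigma_additive. Qed.

HB.instance Definition _ := isMeasure.Build _ _ _ lebesgue_cons
  lebesgue_cons0 lebesgue_cons_ge0 lebesgue_cons_sigma_additive.

Let lebesgue_cons_sigma_finite : sigma_finite setT lebesgue_cons.
Proof.
have /sigma_finiteP[F [TF ndF Foo]] := sigma_finiteT (@lebesgue_measure R).
have /sigma_finiteP[G [TG ndG Goo]] := sigma_finiteT mu.
pose head (t : Rtuple R n.+1) : measurableTypeR R := tnth t ord0.
pose tail (t : Rtuple R n.+1) : Rtuple R n := [tuple of behead t].
exists (fun i => (head @^-1` F i) `&` (tail @^-1` G i)).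
  rewrite predeqE => t; split => // _.
  have [i _ Fi] : (\bigcup_i F i) (head t) by rewrite -TF.
  have [k _ Gk] : (\bigcup_i G i) (tail t) by rewrite -TG.
  exists (maxn i k) => //; split.
  - by have /subsetPset := ndF _ _ (leq_maxl i k); exact.
  - by have /subsetPset := ndG _ _ (leq_maxr i k); exact.
move=> i; have [mF Fi] := Foo i; have [mG Gi] := Goo i; split.
  apply: measurableI; rewrite -[X in measurable X]setTI.
    exact: measurable_tnth.
  exact: measurable_behead.
rewrite /lebesgue_cons /pushforward (_ : _ @^-1` _ = F i `*` G i).
  by rewrite product_measure1E// lte_mul_pinfty// ge0_fin_numE.
apply/seteqP; split=> -[x t] /=.
  by rewrite /tail /tuple_cons/= (_ : [tuple of _] = t)//; exact/val_inj.
by rewrite /tail /tuple_cons/= (_ : [tuple of _] = t)//; exact/val_inj.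
Qed.

HB.instance Definition _ := Measure_isSigmaFinite.Build _ _ _ lebesgue_cons
  lebesgue_cons_sigma_finite.

End step.

Definition lebesgue_nil : set (Rtuple R 0) -> \bar R :=
  \d_([tuple] : Rtuple R 0).

HB.instance Definition _ := FiniteMeasure.on lebesgue_nil.

Fixpoint lebesgue_tuple n : {sigma_finite_measure set (Rtuple R n) -> \bar R} :=
  match n with
  | 0 => lebesgue_nil
  | n.+1 => lebesgue_cons (lebesgue_tuple n)
  end.

Lemma lebesgue_tupleS n (A : set (measurableTypeR R)) (C : set (Rtuple R n)) :
  measurable A -> measurable C ->
  lebesgue_tuple n.+1 [set t | A (tnth t ord0) /\ C [tuple of behead t]] =
  lebesgue_measure A * lebesgue_tuple n C.
Proof.
move=> mA mC; rewrite -product_measure1E//=.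
rewrite /lebesgue_cons /pushforward; congr (_ _).
apply/seteqP; split=> -[x t] /=; rewrite /tuple_cons/= (_ : [tuple of _] = t)//.
  by apply/val_inj.
by apply/val_inj.
Qed.

Lemma measurable_cube n (A : set (measurableTypeR R)) : measurable A ->
  measurable [set t : Rtuple R n | forall i, A (tnth t i)].
Proof.
move=> mA; rewrite [X in measurable X](_ : _ =
    \bigcap_(i in [set: 'I_n]) ((@tnth n _)^~ i @^-1` A)).
  apply: fin_bigcap_measurable => // i _; rewrite -[X in measurable X]setTI.
  exact: measurable_tnth.
by apply/seteqP; split=> t h i; [move=> _|]; exact: h.
Qed.

Lemma lebesgue_tuple_cube n (A : set (measurableTypeR R)) : measurable A ->
  lebesgue_tuple n [set t | forall i, A (tnth t i)] = lebesgue_measure A ^+ n.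
Proof.
move=> mA; elim: n => [|n IHn].
  have -> : [set t : Rtuple R 0 | forall i, A (tnth t i)] = setT.
    by apply/seteqP; split=> // t _ [].
  exact: diracT.
rewrite expeS -IHn -lebesgue_tupleS//; last exact: measurable_cube.
congr (_ _); apply/seteqP; split=> t /= h.
  by split=> // i; have := h (lift ord0 i); rewrite {1}(tuple_eta t) tnthS.
case: h => h0 h i; case: (unliftP ord0 i) => [j|] ->//.
by rewrite (tuple_eta t) tnthS.
Qed.

End lebesgue_tuple.

Section sphere.
Context {R : realType}.
Variable n : nat.

Definition euclidean_norm (t : Rtuple R n) : R :=
  Num.sqrt (\sum_(i < n) (tnth t i : R) ^+ 2).

Definition normalize (t : Rtuple R n) : Rtuple R n :=
  [tuple (tnth t i : R) / euclidean_norm t | i < n].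

Definition punctured_ball : set (Rtuple R n) :=
  [set t | 0 < euclidean_norm t <= 1].

Lemma measurable_euclidean_norm : measurable_fun [set: _] euclidean_norm.
Proof.
rewrite (_ : euclidean_norm =
  fun t => (\sum_(i < n) (tnth t i : R) ^+ 2) `^ 2^-1); last first.
  by apply/funext => t; rewrite powR12_sqrt// sumr_ge0// => i _; exact: sqr_ge0.
apply: (measurableT_comp (measurable_powR _)).
apply: measurable_sum => i; apply: measurable_funX.
exact: measurable_tnth.
Qed.

Lemma measurable_normalize : measurable_fun [set: _] normalize.
Proof.
apply/measurable_fun_tnthP => i.
rewrite (_ : _ \o _ = fun t => (tnth t i : R) * euclidean_norm t `^ (-1)).
  apply: measurable_funM; first exact: measurable_tnth.
  apply: (measurableT_comp (measurable_powR _)).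
  exact: measurable_euclidean_norm.
by apply/funext => t /=; rewrite tnth_mktuple powR_inv1// sqrtr_ge0.
Qed.

Lemma measurable_punctured_ball : measurable punctured_ball.
Proof.
rewrite (_ : punctured_ball = setT `&` euclidean_norm @^-1` `]0, 1]).
  exact: measurable_euclidean_norm.
by rewrite setTI; apply/seteqP; split=> t /=; rewrite in_itv.
Qed.

Local Open Scope ereal_scope.

Definition sphere_measure : set (Rtuple R n) -> \bar R := fun E =>
  (fine (lebesgue_tuple n punctured_ball))^-1%:E *
  lebesgue_tuple n (punctured_ball `&` normalize @^-1` E).

Let sphere_measure0 : sphere_measure set0 = 0.
Proof. by rewrite /sphere_measure preimage_set0 setI0 measure0 mule0. Qed.

Let sphere_measure_ge0 E : 0 <= sphere_measure E.
Proof. by rewrite mule_ge0// lee_fin invr_ge0 fine_ge0. Qed.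

Let sphere_measure_sigma_additive : semi_sigma_additive sphere_measure.
Proof.
have mnorm := measurable_normalize.
have r0 : (0 <= (fine (lebesgue_tuple n punctured_ball : \bar R))^-1)%R.
  by rewrite invr_ge0 fine_ge0.
have nu_additive : semi_sigma_additive (pushforward
    (mrestr (lebesgue_tuple n) measurable_punctured_ball) normalize).
  exact: measure_semi_sigma_additive.
move=> F mF tF mUF; rewrite /sphere_measure.
have := nu_additive F mF tF mUF.
rewrite /pushforward /mrestr setIC.
move=> /(@cvgeZl _ _ _ _ _ (fine (lebesgue_tuple n punctured_ball))^-1%:E isT).
apply: cvg_trans; apply: near_eq_cvg; apply: nearW => k /=.
by rewrite ge0_sume_distrr//; apply: eq_bigr => i _; rewrite setIC.
Qed.

HB.instance Definition _ := isMeasure.Build _ _ _ sphere_measure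
  sphere_measure0 sphere_measure_ge0 sphere_measure_sigma_additive.

Lemma sphere_measure_sphere :
  sphere_measure [set t | euclidean_norm t = 1%R] = sphere_measure setT.
Proof.
rewrite /sphere_measure preimage_setT setIT; congr (_ * lebesgue_tuple n _).
apply/setIidPl => t /= /andP[t0 _].
rewrite /euclidean_norm /normalize.
under eq_bigr do rewrite tnth_mktuple expr_div_n.
rewrite -mulr_suml sqrtrM; last by rewrite sumr_ge0// => i _; exact: sqr_ge0.
rewrite sqrtrV ?sqr_ge0// sqrtr_sqr -/(euclidean_norm t) ger0_norm ?ltW//.
by rewrite mulfV// gt_eqF.
Qed.

Lemma punctured_ball_lty : lebesgue_tuple n punctured_ball < +oo.
Proof.
have mI : measurable (`[(-1)%R, 1%R]%classic : set (measurableTypeR R)).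
  exact: measurable_itv.
apply: (@le_lt_trans _ _
  (lebesgue_tuple n [set t | forall i, `[(-1)%R, 1%R]%classic (tnth t i)])).
  apply: le_measure; rewrite ?inE.
  - exact: measurable_punctured_ball.
  - exact: measurable_cube.
  move=> t /= /andP[_ t1] i; rewrite in_itv/= -ler_norml.
  apply: le_trans t1; rewrite -sqrtr_sqr ler_wsqrtr//.
  by rewrite (bigD1 i)//= lerDl sumr_ge0// => j _; exact: sqr_ge0.
rewrite lebesgue_tuple_cube// lebesgue_measure_itv/=.
by case: ifP => _; rewrite -?EFinB -?EFin_expe ltry.
Qed.

Lemma punctured_ball_gt0 : (0 < n)%N -> 0 < lebesgue_tuple n punctured_ball.
Proof.
move=> n0; have n0R : (0 < n%:R :> R)%R by rewrite ltr0n.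
have mI : measurable (`]0%R, (n%:R^-1)%R]%classic : set (measurableTypeR R)).
  exact: measurable_itv.
apply: (@lt_le_trans _ _
  (lebesgue_tuple n [set t | forall i, `]0%R, (n%:R^-1)%R]%classic (tnth t i)])).
  rewrite lebesgue_tuple_cube// lebesgue_measure_itv/= lte_fin invr_gt0 n0R.
  by rewrite -EFinB -EFin_expe lte_fin subr0 exprn_gt0// invr_gt0.
apply: le_measure; rewrite ?inE.
- exact: measurable_cube.
- exact: measurable_punctured_ball.
move=> t /= h; apply/andP; split.
  rewrite sqrtr_gt0 (bigD1 (Ordinal n0))//= ltr_pwDl//.
    have /itvP h0 := h (Ordinal n0); by rewrite exprn_gt0// h0.
  by rewrite sumr_ge0// => j _; exact: sqr_ge0.
rewrite -sqrtr1 ler_wsqrtr//.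
apply: (@le_trans _ _ (\sum_(i < n) (n%:R^-1 : R))%R).
  apply: ler_sum => i _; have /itvP h0 := h i.
  rewrite expr2 -[leRHS]mulr1 ler_pM ?h0//.
  by rewrite (@le_trans _ _ n%:R^-1%R) ?h0// invf_le1// ler1n.
by rewrite sumr_const card_ord -[leLHS]mulr_natr mulVf// gt_eqF.
Qed.

Lemma sphere_measure_setT : (0 < n)%N -> sphere_measure setT = 1.
Proof.
move=> n0; rewrite /sphere_measure preimage_setT setIT.
have := punctured_ball_gt0 n0; have := punctured_ball_lty.
case: (lebesgue_tuple n punctured_ball) => // r _; rewrite lte_fin => r0 /=.
by rewrite -EFinM mulVf// gt_eqF.
Qed.

End sphere.
Arguments sphere_measure : clear implicits.

Section gradient_descent.
Context {R : realType} {n : nat}.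
Implicit Types (A : 'M[R]_n) (x : 'cV[R]_n).

Definition quad A x : R := (x^T *m A *m x) 0 0.

(* Exact line search gradient descent for x |-> x^T A x / 2. *)
Definition ogd A x : 'cV[R]_n :=
  if x == 0 then 0 else x - (quad (A ^+ 2) x / quad (A ^+ 3) x) *: (A *m x).

Definition shrinking_factor A x : R :=
  if x == 0 then 0
  else Num.sqrt (1 - quad (A ^+ 2) x ^+ 2 / (quad A x * quad (A ^+ 3) x)).

Definition ogd_rate A x : \bar R :=
  limn_esup (fun k : nat =>
    ((\prod_(j < k) shrinking_factor A (iter j (ogd A) x)) `^ k%:R^-1)%:E).

End gradient_descent.

(* Main.v *)
Require Import Defs.
From HB Require Import structures.
From mathcomp Require Import all_boot all_order all_algebra.
From mathcomp Require Import all_classical all_reals all_analysis.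
From mathcomp Require Import ess_sup_inf.
From mathcomp Require Import measurable_realfun ring lra.
Import Order.TTheory GRing.Theory Num.Theory numFieldNormedType.Exports.
Local Open Scope classical_set_scope.
Local Open Scope ring_scope.

(** Write [lambda_i = H (c + l_i)] with [l_i] in [[-1, 1]], the values [1] and
    [-1] being taken at the extreme eigenvalues.  If [g = A x] is the gradient,
    the weights [p_i = g_i ^ 2 / |g| ^ 2] form a probability distribution on the
    indices.  With [m] and [V] the mean and the variance of [l] under [p], a
    step of the method multiplies [g_i] by [(m - l_i) / (c + m)]; hence it
    multiplies [p_i] by [(l_i - m) ^ 2 / V] and [|g| ^ 2] by
    [V / (c + m) ^ 2].  The whole problem is about this dynamics of weights.

    For a start with nonzero extreme components the rate exists as a limit.  The
    variance never decreases ([var_increment], Akaike), so it converges to some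
    [V_oo].  Its increment is a weighted sum of the squares
    [((l_i - m) (l_i - m') - V) ^ 2], with [m'] the next mean, and the product
    of the two extreme weights never decreases ([extreme_product_reweight]).  Therefore these squares tend to [0] at
    [l_i = 1] and [l_i = -1], which forces [m + m' --> 0] and
    [m m' --> V_oo - 1]: the iterates settle on a zigzag between the two extreme
    eigenvectors.  It follows that the rate equals
    [sqrt (V_oo / (c ^ 2 - 1 + V_oo))], an increasing function of [V_oo]
    ([ogd_rateE]).

    Lower bound.  Let [l_i] be an intermediate node whose weight never vanishes.
    In two steps its weight is eventually multiplied by nearly
    [((l_i ^ 2 + V_oo - 1) / V_oo) ^ 2], which would exceed [1] if
    [V_oo < (1 - l_i ^ 2) / 2]; a weight cannot grow for ever, so
    [(1 - l_i ^ 2) / 2 <= V_oo] ([limit_var_ge]).  The starting points for which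
    the weight of [i] vanishes at some step are zeros of polynomials.  These are
    not identically zero, because a start supported by [i] and the top index
    keeps both components alive, and the zero set of such a polynomial is null
    ([polyfun_zeros_null]).  Taking for [l_i] the intermediate node closest to
    [0], i.e. [|l_i| = delta], gives [V_oo >= (1 - delta ^ 2) / 2] almost
    everywhere.

    Upper bound.  If the variance already exceeds [(1 - delta ^ 2) / 2], the
    two-step factor is less than [1] at every intermediate node.  So, starting
    with small intermediate weights, these decay geometrically and the variance
    hardly moves ([limit_var_le]).  For each [v1 > (1 - delta ^ 2) / 2], the
    starts with [V_oo < v1] thus contain a nonempty open set, which the measure
    charges ([sphere_ae_open]). *)

(** * Weights on the nodes and one step of the dynamics *)

Section distributions.
Context {R : realType} {I : finType}.
Implicit Types (l p f : I -> R).

Definition expect p f : R := \sum_i p i * f i.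
Definition is_dist p := (forall i, 0 <= p i) /\ \sum_i p i = 1.
Definition mean l p : R := expect p l.
Definition var l p : R := expect p (fun i => (l i - mean l p) ^+ 2).
(** The action on the weights [g_i ^ 2 / |g| ^ 2] of one step of the method. *)
Definition reweight l p : I -> R := fun i => p i * (l i - mean l p) ^+ 2 / var l p.
(** For [l] with values in [[-1, 1]], the nodes [1] and [-1] do not contribute:
    the defect measures the mass that escapes from them, and vanishes exactly
    for the distributions carried by these two values. *)
Definition defect l p : R := expect p (fun i => 1 - l i ^+ 2).

(** The identities below compare polynomials of degree at most [4] in a variable;
    this reduces them to identities between coefficients. *)
Lemma expect_quartic p y f a0 a1 a2 a3 a4 :
    (forall i, f i = a0 + a1 * y i + a2 * y i ^+ 2 + a3 * y i ^+ 3 + a4 * y i ^+ 4) ->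
  expect p f = a0 * \sum_i p i + a1 * expect p y + a2 * expect p (fun i => y i ^+ 2)
    + a3 * expect p (fun i => y i ^+ 3) + a4 * expect p (fun i => y i ^+ 4).
Proof.
move=> fE; rewrite /expect !mulr_sumr -!big_split/=; apply: eq_bigr => i _.
by rewrite fE; ring.
Qed.

Lemma expect_ge0 p f : (forall i, 0 <= p i) -> (forall i, 0 <= f i) -> 0 <= expect p f.
Proof. by move=> p0 f0; apply: sumr_ge0 => i _; rewrite mulr_ge0. Qed.

Lemma expect_term_le p f i : (forall i, 0 <= p i) -> (forall i, 0 <= f i) ->
  p i * f i <= expect p f.
Proof.
move=> p0 f0; rewrite /expect (bigD1 i)//= lerDl.
by apply: sumr_ge0 => j _; rewrite mulr_ge0.
Qed.

Section one_step.
Context (l p : I -> R).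
Hypothesis p_dist : is_dist p.

Let m := mean l p.
Let V := var l p.
Let M3 := expect p (fun i => (l i - m) ^+ 3).
Let M4 := expect p (fun i => (l i - m) ^+ 4).
Let p0 : forall i, 0 <= p i. Proof. by case: p_dist. Qed.
Let p1 : \sum_i p i = 1. Proof. by case: p_dist. Qed.

(** For a centred variable the moments of order [0] and [1] are [1] and [0], so
    every expectation below is a combination of [V], [M3] and [M4]. *)
Lemma expect_centred f a0 a1 a2 a3 a4 :
    (forall i, f i = a0 + a1 * (l i - m) + a2 * (l i - m) ^+ 2
       + a3 * (l i - m) ^+ 3 + a4 * (l i - m) ^+ 4) ->
  expect p f = a0 + a2 * V + a3 * M3 + a4 * M4.
Proof.
move=> fE; rewrite (expect_quartic p (fun i => l i - m) f a0 a1 a2 a3 a4)// p1.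
suff -> : expect p (fun i => l i - m) = 0 by rewrite mulr0 addr0 mulr1.
rewrite (expect_quartic p l _ (- m) 1 0 0 0); last by move=> i; ring.
by rewrite p1 -/(mean l p) -/m; ring.
Qed.

Lemma defectE : defect l p = 1 - m ^+ 2 - V.
Proof.
rewrite /defect (expect_centred _ (1 - m ^+ 2) (- 2 * m) (-1) 0 0); first by ring.
by move=> i; ring.
Qed.

Lemma var_ge0 : 0 <= V.
Proof. by apply: expect_ge0 => // i; exact: sqr_ge0. Qed.

Hypothesis V_gt0 : 0 < V.
Let V_neq0 : V != 0. Proof. exact: lt0r_neq0. Qed.

Lemma expect_reweight f : expect (reweight l p) f =
  expect p (fun i => (l i - m) ^+ 2 * f i) / V.
Proof.
rewrite /expect mulr_suml; apply: eq_bigr => i _; rewrite /reweight -/m -/V.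
by field.
Qed.

Lemma reweight_dist : is_dist (reweight l p).
Proof.
split => [i|]; first by rewrite /reweight divr_ge0 ?var_ge0// mulr_ge0 ?sqr_ge0.
by rewrite /reweight -mulr_suml -/V divff.
Qed.

Let m' := mean l (reweight l p).
Let V' := var l (reweight l p).

Lemma mean_reweight : m' = m + M3 / V.
Proof.
rewrite /m' /mean expect_reweight (expect_centred _ 0 0 m 1 0).
  by field.
by move=> i; ring.
Qed.

Lemma var_reweight : V' = M4 / V - (M3 / V) ^+ 2.
Proof.
rewrite /V' /var expect_reweight -/(mean l _) -/m' mean_reweight.
set d := M3 / V.
rewrite (expect_centred _ 0 0 (d ^+ 2) (- 2 * d) 1).
  by rewrite /d; field.
by move=> i; ring.
Qed.

(** Akaike's monotonicity of the variance: with [y = l - m] and [d = m' - m], the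
    polynomial [y (y - d) - V] is what remains of [y ^ 2] after projection on the
    span of [1] and [y]; its squared norm [M4 - d ^ 2 V - V ^ 2] is [V (V' - V)]. *)
Lemma var_increment :
  expect p (fun i => ((l i - m) * (l i - m') - V) ^+ 2) = V * (V' - V).
Proof.
rewrite mean_reweight var_reweight; set d := M3 / V.
rewrite (expect_centred _ (V ^+ 2) (2 * V * d) (d ^+ 2 - 2 * V) (- 2 * d) 1).
  by rewrite /d; field.
by move=> i; ring.
Qed.

Lemma var_reweight_ge : V <= V'.
Proof.
rewrite -subr_ge0 -(pmulr_rge0 _ V_gt0) -var_increment.
by apply: expect_ge0 => // i; exact: sqr_ge0.
Qed.

(** On two nodes at [1] and [-1] the mean changes sign at each step; the right
    hand side shows that in general the deviation is controlled by the defect. *)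
Lemma mean_reweightD : V * (m + m') = m * defect l p - expect p (fun i => l i * (1 - l i ^+ 2)).
Proof.
rewrite mean_reweight defectE.
rewrite (expect_centred _ (m - m ^+ 3) (1 - 3 * m ^+ 2) (- 3 * m) (-1) 0).
  by field.
by move=> i; ring.
Qed.

Lemma reweight2 i : reweight l (reweight l p) i =
  p i * ((l i - m) * (l i - m')) ^+ 2 / (V * V').
Proof.
rewrite {1}/reweight -/m' -/V' /reweight -/m -/V.
have V'0 : V' != 0 by rewrite gt_eqF// (lt_le_trans V_gt0)// var_reweight_ge.
by field; rewrite V_neq0 V'0.
Qed.

End one_step.

Section bounded.
Context (l p : I -> R).
Hypothesis p_dist : is_dist p.
Hypothesis l_bound : forall i, `|l i| <= 1.
Let p0 : forall i, 0 <= p i. Proof. by case: p_dist. Qed.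
Let p1 : \sum_i p i = 1. Proof. by case: p_dist. Qed.
Let w0 i : 0 <= 1 - l i ^+ 2.
Proof. by rewrite subr_ge0 -real_normK ?num_real// expr_le1. Qed.

Lemma expect_norm_le f g : (forall i, `|f i| <= g i) -> `|expect p f| <= expect p g.
Proof.
move=> fg; apply: le_trans (ler_norm_sum _ _ _) _; apply: ler_sum => i _.
by rewrite normrM ger0_norm// ler_wpM2l.
Qed.

Lemma mean_norm_le1 : `|mean l p| <= 1.
Proof.
rewrite -p1; apply: le_trans (expect_norm_le l (fun=> 1) _) _ => //.
by apply: ler_sum => i _; rewrite mulr1.
Qed.

Lemma defect_ge0 : 0 <= defect l p.
Proof. exact: expect_ge0. Qed.

Lemma var_le1 : var l p <= 1.
Proof.
have := defect_ge0; rewrite defectE//; have := sqr_ge0 (mean l p); lra.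
Qed.

Lemma mean_drift : 0 < var l p ->
  `|mean l p + mean l (reweight l p)| <= 2 * defect l p / var l p.
Proof.
move=> V0; rewrite ler_pdivlMr// -{1}(ger0_norm (ltW V0)) -normrM mulrC.
rewrite mean_reweightD//; apply: le_trans (ler_normB _ _) _.
rewrite mulr_natl mulr2n lerD//.
  by rewrite normrM (ger0_norm defect_ge0) ler_piMl ?defect_ge0 ?mean_norm_le1.
by apply: expect_norm_le => i; rewrite normrM (ger0_norm (w0 i)) ler_piMl.
Qed.

Lemma sqr_dev_le4 i : (l i - mean l p) ^+ 2 <= 4.
Proof.
have := l_bound i; have := mean_norm_le1; rewrite !ler_norml => /andP[? ?] /andP[? ?].
nra.
Qed.

Lemma defect_reweight : 0 < var l p ->
  defect l (reweight l p) <= 4 / var l p * defect l p.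
Proof.
move=> V0; rewrite {1}/defect expect_reweight//.
rewrite mulrAC ler_pM2r ?invr_gt0// /defect /expect mulr_sumr.
apply: ler_sum => i _; rewrite mulrCA ler_wpM2r ?mulr_ge0//.
exact: sqr_dev_le4.
Qed.

(** Near the two-node distributions [V] is close to [1 - m ^ 2], and [m ^ 2] is
    almost invariant by [mean_drift]. *)
Lemma var_reweight_le : 0 < var l p ->
  var l (reweight l p) <= var l p + (4 / var l p + 1) * defect l p.
Proof.
move=> V0; have pd := reweight_dist l p p_dist V0.
have e' : 0 <= defect l (reweight l p).
  by apply: expect_ge0 => //; case: pd.
have := mean_drift V0; have e0 := defect_ge0.
have dE := defectE l p p_dist; have dE' := defectE l _ pd.
set m' := mean l (reweight l p) in dE' *; set m := mean l p in dE *.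
have m1 : `|m| <= 1 := mean_norm_le1.
have m1' : `|m'| <= 1.
  rewrite -pd.2; apply: le_trans (ler_norm_sum _ _ _) _; apply: ler_sum => i _.
  by rewrite normrM (ger0_norm (pd.1 i)) ler_piMr// pd.1.
have mm : (m - m') * (m + m') <= 2 * `|m + m'|.
  apply: le_trans (ler_norm _) _; rewrite normrM ler_wpM2r//.
  by apply: le_trans (ler_normB _ _) _; lra.
set Q := 2 * _ / var l p => mmQ.
have -> : (4 / var l p + 1) * defect l p = 2 * Q + defect l p by rewrite /Q; ring.
nra.
Qed.

End bounded.
End distributions.

(** * Asymptotics of the weights along an orbit *)

Lemma eq_cvgn {R : realType} [u v : R^nat] [a b : R] :
  u @ \oo --> a -> u =1 v -> a = b -> v @ \oo --> b.
Proof. by move=> ua /funext <- <-. Qed.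

Section orbit.
Context {R : realType} {I : finType}.

Definition limit_var (l p : I -> R) : R :=
  limn (fun k => var l (iter k (reweight l) p)).

Context (l : I -> R) (top bot : I).
Hypothesis l_bound : forall i, `|l i| <= 1.
Hypothesis l_top : l top = 1.
Hypothesis l_bot : l bot = -1.

Definition two_sided (p : I -> R) := [/\ is_dist p, 0 < p top & 0 < p bot].

Lemma two_sided_var_gt0 p : two_sided p -> 0 < var l p.
Proof.
move=> [pd ptop pbot]; rewrite lt_neqAle var_ge0// andbT eq_sym.
apply/eqP => V0.
have z i : 0 < p i -> l i = mean l p.
  move=> pi0; have := expect_term_le p (fun i => (l i - mean l p) ^+ 2) i pd.1 (fun i => sqr_ge0 _).
  rewrite -/(var l p) V0 pmulr_rle0// => h.
  by apply/eqP; rewrite -subr_eq0 -sqrf_eq0 eq_le h sqr_ge0.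
have := z _ ptop; rewrite -(z _ pbot) l_top l_bot; lra.
Qed.

(** The weights at [1] and [-1] are multiplied by [(1 - m) ^ 2 / V] and
    [(1 + m) ^ 2 / V], and [V <= (1 - m) (1 + m)] since the defect is
    nonnegative. *)
Lemma extreme_product_reweight p : two_sided p ->
  p top * p bot <= reweight l p top * reweight l p bot.
Proof.
move=> p2; have V0 := two_sided_var_gt0 p p2; have [pd ptop pbot] := p2.
have -> : reweight l p top * reweight l p bot =
    p top * p bot * ((1 - mean l p ^+ 2) / var l p) ^+ 2.
  by rewrite /reweight l_top l_bot; field; rewrite gt_eqF.
have := defect_ge0 l p pd l_bound; rewrite defectE// => h.
have ratio_ge1 : 1 <= (1 - mean l p ^+ 2) / var l p by rewrite ler_pdivlMr//; lra.
by rewrite ler_peMr ?mulr_ge0 ?pd.1// expr_ge1// (le_trans ler01).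
Qed.

Lemma two_sided_reweight p : two_sided p -> two_sided (reweight l p).
Proof.
move=> p2; have V0 := two_sided_var_gt0 p p2; have [pd ptop pbot] := p2.
have pd' := reweight_dist l p pd V0.
have := extreme_product_reweight p p2; have := mulr_gt0 ptop pbot.
move=> /lt_le_trans /[apply] h.
split=> //.
  by rewrite lt_neqAle pd'.1 andbT eq_sym; apply/eqP => z; rewrite z mul0r ltxx in h.
by rewrite lt_neqAle pd'.1 andbT eq_sym; apply/eqP => z; rewrite z mulr0 ltxx in h.
Qed.

Context (p : I -> R).
Hypothesis p_two : two_sided p.
Let P k := iter k (reweight l) p.
Let m k := mean l (P k).
Let V k := var l (P k).

Lemma two_sided_iter k : two_sided (P k).
Proof. by elim: k => //= k; exact: two_sided_reweight. Qed.

Let Pd k : is_dist (P k). Proof. by case: (two_sided_iter k). Qed.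
Let V_gt0 k : 0 < V k. Proof. exact/two_sided_var_gt0/two_sided_iter. Qed.

Lemma extreme_product_iter k : p top * p bot <= P k top * P k bot.
Proof.
elim: k => // k /le_trans; apply.
by apply: extreme_product_reweight; exact: two_sided_iter.
Qed.

Lemma weight_le1 k i : P k i <= 1.
Proof.
by rewrite -(Pd k).2 (bigD1 i)//= lerDl sumr_ge0// => j _; exact: (Pd k).1.
Qed.

Lemma var_iter_nondecreasing : nondecreasing_seq V.
Proof. by apply/nondecreasing_seqP => k; apply: var_reweight_ge => //; exact: V_gt0. Qed.

Lemma var_iter_cvg : V @ \oo --> limit_var l p.
Proof.
apply: nondecreasing_is_cvgn; first exact: var_iter_nondecreasing.
by exists 1 => _ [k _ <-]; exact: (var_le1 l (P k) (Pd k)).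
Qed.

Lemma var_iter_le k : V k <= limit_var l p.
Proof.
apply: nondecreasing_cvgn_le; first exact: var_iter_nondecreasing.
exact: var_iter_cvg.
Qed.

Lemma limit_var_gt0 : 0 < limit_var l p.
Proof. exact: lt_le_trans (V_gt0 0%N) (var_iter_le 0). Qed.

(** The variance increments tend to [0] and dominate [kappa] times the square of
    [(l i - m k) (l i - m k.+1) - V k]. *)
Lemma persistent_node i kappa : 0 < kappa -> (\forall k \near \oo, kappa <= P k i) ->
  (l i - m k) * (l i - m k.+1) @[k --> \oo] --> limit_var l p.
Proof.
move=> k0 kP.
pose al k := (l i - m k) * (l i - m k.+1) - V k.
suff al0 : al @ \oo --> 0.
  rewrite -[limit_var _ _]add0r.
  rewrite (_ : (fun _ => _) = (fun k => al k + V k)).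
    exact: cvgD al0 var_iter_cvg.
  by apply/funext => k; rewrite /al subrK.
have dV : V k.+1 - V k @[k --> \oo] --> 0.
  rewrite -(subrr (limit_var l p)); apply: cvgB; last exact: var_iter_cvg.
  by rewrite cvg_shiftS; exact: var_iter_cvg.
have sq0 : al k ^+ 2 @[k --> \oo] --> 0.
  apply: (@squeeze_cvgr _ _ _ _ (cst 0) (fun k => kappa^-1 * (V k.+1 - V k))).
  - near=> k; rewrite sqr_ge0/= ler_pdivlMl//.
    apply: (@le_trans _ _ (P k i * al k ^+ 2)).
      by rewrite ler_wpM2r ?sqr_ge0//; near: k.
    have := expect_term_le _
      (fun j => ((l j - m k) * (l j - m k.+1) - V k) ^+ 2) i (Pd k).1.
    move=> /(_ (fun=> sqr_ge0 _)) /le_trans; apply.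
    rewrite var_increment ?V_gt0//.
    rewrite ler_piMl ?(var_le1 l (P k) (Pd k))// subr_ge0.
    by apply: var_reweight_ge => //; exact: V_gt0.
  - exact: cvg_cst.
  - by rewrite -(mulr0 kappa^-1); apply: cvgM => //; exact: cvg_cst.
apply/norm_cvg0P.
rewrite (_ : (fun _ => _) = (fun k => Num.sqrt (al k ^+ 2))); last first.
  by apply/funext => k; rewrite sqrtr_sqr.
rewrite -[X in _ --> X](sqrtr0 R); apply: (continuous_cvg _ _ sq0).
exact: sqrt_continuous.
Unshelve. all: by end_near. Qed.

(** A weight is at most [1], so a lower bound on the product of the extreme
    weights bounds each of them. *)
Lemma extremes_persist k : p top * p bot <= P k top /\ p top * p bot <= P k bot.
Proof.
have [_ t0 b0] := two_sided_iter k; have := extreme_product_iter k.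
have := weight_le1 k top; have := weight_le1 k bot.
by move=> ? ? h; split; apply: le_trans h _; rewrite ?ler_piMl ?ler_piMr// ltW.
Qed.

Let kappa_gt0 : 0 < p top * p bot.
Proof. by case: p_two => _ ? ?; exact: mulr_gt0. Qed.

Let top_cvg : (1 - m k) * (1 - m k.+1) @[k --> \oo] --> limit_var l p.
Proof.
rewrite -l_top; apply: (persistent_node _ _ kappa_gt0).
by apply: nearW => k; case: (extremes_persist k).
Qed.

Let bot_cvg : (-1 - m k) * (-1 - m k.+1) @[k --> \oo] --> limit_var l p.
Proof.
rewrite -l_bot; apply: (persistent_node _ _ kappa_gt0).
by apply: nearW => k; case: (extremes_persist k).
Qed.

Lemma mean_sum_cvg : m k + m k.+1 @[k --> \oo] --> 0.
Proof.
apply: (eq_cvgn (cvgM (cvg_cst (2^-1 : R)) (cvgB bot_cvg top_cvg))).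
  by move=> k /=; rewrite !fctE /=; field.
by rewrite subrr mulr0.
Qed.

Lemma mean_prod_cvg : m k * m k.+1 @[k --> \oo] --> limit_var l p - 1.
Proof.
apply: (eq_cvgn (cvgB (cvgM (cvg_cst (2^-1 : R)) (cvgD bot_cvg top_cvg))
  (cvg_cst (1 : R)))); last by field.
by move=> k /=; rewrite !fctE /=; field.
Qed.

(** Asymptotically [m k.+1 = - m k] and [m k ^ 2 = 1 - limit_var l p]: the case
    [z = - l i] gives the two-step factor of the node [i], and [z = c] the
    two-step decrease of the gradient. *)
Lemma shifted_prod_cvg z :
  (z + m k) * (z + m k.+1) @[k --> \oo] --> z ^+ 2 - 1 + limit_var l p.
Proof.
apply: (eq_cvgn (cvgD (cvgD (cvg_cst (z ^+ 2)) (cvgM (cvg_cst z) mean_sum_cvg))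
  mean_prod_cvg)); last by ring.
by move=> k /=; rewrite !fctE /=; ring.
Qed.

(** Below the stated bound the two-step factor of the node [i] would eventually
    exceed [1], so its weight would stay away from [0]; [persistent_node] would
    then force [l i ^ 2 = 1]. *)
Lemma limit_var_ge i : `|l i| < 1 -> (forall k, 0 < P k i) ->
  (1 - l i ^+ 2) / 2 <= limit_var l p.
Proof.
move=> li1 Pi0; rewrite leNgt; apply/negP => small.
have w0 : 0 < 1 - l i ^+ 2 by rewrite subr_gt0 -real_normK ?num_real// expr_lt1.
have cv : (l i - m k) * (l i - m k.+1) @[k --> \oo] --> l i ^+ 2 - 1 + limit_var l p.
  apply: (eq_cvgn (shifted_prod_cvg (- l i))); last by ring.
  by move=> k /=; ring.
have lim0 := limit_var_gt0.
suff [kappa k0 kP] : exists2 kappa, 0 < kappa & \forall k \near \oo, kappa <= P k i.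
  have E : limit_var l p = l i ^+ 2 - 1 + limit_var l p.
    exact: (cvg_unique _ (persistent_node _ _ k0 kP) cv).
  move: w0 E; set a := l i ^+ 2; set b := limit_var l p; lra.
have [K _ KP] : \forall k \near \oo, (l i - m k) * (l i - m k.+1) < - limit_var l p.
  by apply: (cvgr_lt _ cv); lra.
have grow k : (K <= k)%N -> P k i <= P k.+2 i.
  move=> /KP /= h; have VV : 0 < V k * V k.+1 by rewrite mulr_gt0.
  rewrite [leRHS](reweight2 _ _ (Pd k) (V_gt0 k)) -/(m k) -/(m k.+1) -/(V k) -/(V k.+1).
  rewrite ler_pdivlMr// ler_wpM2l ?(Pd k).1//.
  have V1 : V k <= limit_var l p := var_iter_le k.
  have V2 : V k.+1 <= limit_var l p := var_iter_le k.+1.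
  have := V_gt0 k; have := V_gt0 k.+1; nra.
exists (Num.min (P K i) (P K.+1 i)); first by rewrite lt_min !Pi0.
exists K => // k /= /subnKC <-.
suff : forall j, Num.min (P K i) (P K.+1 i) <= P (K + j)%N i /\
  Num.min (P K i) (P K.+1 i) <= P (K + j).+1 i by move=> /(_ (k - K)%N) [].
elim=> [|j [IH1 IH2]]; first by rewrite addn0 !ge_min !lexx orbT.
rewrite addnS; split=> //; apply: le_trans IH1 _; apply: grow; exact: leq_addr.
Qed.

Section stability.
(** The hypothesis [gap] says, with a margin [g], that [v0] exceeds the critical
    variance [(1 - l i ^ 2) / 2] of every node other than [1] and [-1].  The
    region where the variance is at least [v0] and the defect is small is then
    stable under two steps. *)
Context (v0 g : R).
Hypothesis v0_gt0 : 0 < v0.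
Hypothesis g_gt0 : 0 < g.
Hypothesis gap : forall i, l i ^+ 2 = 1 \/
  2 * g <= 1 - l i ^+ 2 /\ 1 - l i ^+ 2 + 2 * g <= 2 * v0.
Let K := 1 + 4 / v0.

Let K_ge : 1 <= K. Proof. by rewrite lerDl divr_ge0// ltW. Qed.

Section two_step.
Context (q : I -> R).
Hypothesis q_two : two_sided q.
Hypothesis v0_le : v0 <= var l q.
Hypothesis defect_small : K * defect l q <= g.

Let q_dist : is_dist q. Proof. by case: q_two. Qed.
Let W_gt0 : 0 < var l q. Proof. exact: lt_le_trans v0_le. Qed.
Let q'_two : two_sided (reweight l q). Proof. exact: two_sided_reweight. Qed.
Let q'_dist : is_dist (reweight l q). Proof. by case: q'_two. Qed.
Let d_ge0 : 0 <= defect l q. Proof. exact: defect_ge0. Qed.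
Let W'_ge : var l q <= var l (reweight l q).
Proof. exact: var_reweight_ge. Qed.

(** With [m' = - m] and no defect the product would be [V - (1 - l i ^ 2)], which
    by [gap] is at distance at least [2 g] from both [V] and [- V]; by
    [defect_small] the two corrections use up at most [g]. *)
Lemma two_step_factor i : l i ^+ 2 != 1 ->
  `|(l i - mean l q) * (l i - mean l (reweight l q))| <= var l q - g.
Proof.
case: (gap i) => [->|[g1 g2] _]; first by rewrite eqxx.
have := defectE l q q_dist; have := mean_drift l q q_dist l_bound W_gt0.
have := mean_norm_le1 l q q_dist l_bound; have := l_bound i.
set mu := mean l q; set mu' := mean l (reweight l q).
have := v0_le; have := W_gt0; have := d_ge0; have := defect_small.
set W := var l q; set e := defect l q => small e0 W0 v0W.
move=> li mu1 drift eE.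
have dr : `|mu + mu'| <= 2 * e / v0.
  apply: le_trans drift _; rewrite ler_wpM2l ?mulr_ge0//.
  by rewrite lef_pV2 ?posrE.
have rem : `|(l i - mu) * (mu + mu')| <= 4 / v0 * e.
  rewrite (_ : 4 / v0 * e = 2 * (2 * e / v0)); last by ring.
  rewrite normrM ler_pM//; apply: le_trans (ler_normB _ _) _; lra.
have -> : (l i - mu) * (l i - mu') =
    W + e - (1 - l i ^+ 2) - (l i - mu) * (mu + mu') by rewrite eE; ring.
move: rem; have : e + 4 / v0 * e <= g by move: small; rewrite /K; lra.
move: ((l i - mu) * (mu + mu')) (4 / v0 * e) => r z.
rewrite !ler_norml => ez /andP[r1 r2]; apply/andP; split; lra.
Qed.

Lemma two_step_defect :
  defect l (reweight l (reweight l q)) <= (1 - g) * defect l q.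
Proof.
rewrite /defect /expect mulr_sumr; apply: ler_sum => i _.
have [li1|li1] := eqVneq (l i ^+ 2) 1; first by rewrite li1 subrr !mulr0.
have w0 : 0 <= 1 - l i ^+ 2.
  by rewrite subr_ge0 -real_normK ?num_real// expr_le1.
rewrite mulrA ler_wpM2r// reweight2//.
have := two_step_factor i li1.
set A := _ * _; move=> hA.
have VV : 0 < var l q * var l (reweight l q).
  by rewrite mulr_gt0// (lt_le_trans W_gt0).
rewrite ler_pdivrMr// [(1 - g) * _]mulrC -mulrA ler_wpM2l ?q_dist.1//.
have W1 : var l q <= 1 by exact: var_le1.
have {}hA : A ^+ 2 <= (var l q - g) ^+ 2.
  by rewrite -real_normK ?num_real// ler_pXn2r// nnegrE (le_trans _ hA).
apply: le_trans hA _.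
have gW : g <= var l q by rewrite -subr_ge0 (le_trans _ (two_step_factor i li1)).
have : (1 - g) * var l q ^+ 2 <= (1 - g) * (var l q * var l (reweight l q)).
  by rewrite ler_wpM2l ?subr_ge0 ?(le_trans gW)// expr2 ler_wpM2l// ltW.
apply: le_trans.
have h1 : 0 <= g * (var l q * (1 - var l q)).
  by rewrite (mulr_ge0 (ltW g_gt0))// (mulr_ge0 (ltW W_gt0))// subr_ge0.
have h2 : 0 <= g * (var l q - g) by rewrite (mulr_ge0 (ltW g_gt0))// subr_ge0.
nra.
Qed.

Lemma two_step_var :
  var l (reweight l (reweight l q)) <= var l q + K ^+ 2 * defect l q.
Proof.
have W'0 := lt_le_trans W_gt0 W'_ge.
have KV (r : R) : v0 <= r -> 4 / r <= 4 / v0.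
  by move=> r0; rewrite ler_wpM2l// lef_pV2 ?posrE// (lt_le_trans v0_gt0).
have s1 := var_reweight_le l q q_dist l_bound W_gt0.
have s2 := var_reweight_le l _ q'_dist l_bound W'0.
have s3 := defect_reweight l q q_dist l_bound W_gt0.
have k1 := KV _ v0_le; have k2 := KV _ (le_trans v0_le W'_ge).
have d'0 := defect_ge0 l _ q'_dist l_bound.
have s1' : (4 / var l q + 1) * defect l q <= K * defect l q.
  by rewrite ler_wpM2r//; rewrite /K; lra.
have s2' : (4 / var l (reweight l q) + 1) * defect l (reweight l q) <=
    K * defect l (reweight l q) by rewrite ler_wpM2r//; rewrite /K; lra.
have s3' : K * defect l (reweight l q) <= K * ((K - 1) * defect l q).
  rewrite ler_wpM2l ?(le_trans _ K_ge)//; apply: le_trans s3 _.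
  by rewrite ler_wpM2r//; rewrite /K; lra.
have -> : K ^+ 2 * defect l q = K * defect l q + K * ((K - 1) * defect l q) by ring.
lra.
Qed.

End two_step.

(** The quantity [V + K ^ 2 / g * defect] does not increase along even steps: the
    geometric decay of the defect pays for the drift of the variance. *)
Lemma limit_var_le : v0 <= var l p -> K * defect l p <= g ->
  limit_var l p <= var l p + K ^+ 2 / g * defect l p.
Proof.
move=> v0p small.
have inv j : [/\ v0 <= V j.*2, defect l (P j.*2) <= defect l p &
    V j.*2 + K ^+ 2 / g * defect l (P j.*2) <= var l p + K ^+ 2 / g * defect l p].
  elim: j => [//|j [v0j dj Lj]].
  have tj := two_sided_iter j.*2.
  have smallj : K * defect l (P j.*2) <= g.
    by apply: le_trans small; rewrite ler_wpM2l// (le_trans ler01).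
  have := two_step_defect _ tj v0j smallj; have := two_step_var _ tj v0j.
  rewrite -[reweight l (reweight l _)]/(P j.*2.+2) -/(V j.*2.+2) -/(V j.*2) => vs ds.
  have d0 := defect_ge0 l _ (Pd j.*2) l_bound.
  rewrite doubleS; split.
  - apply: le_trans v0j _; apply: var_iter_nondecreasing; exact: leqW.
  - by apply: le_trans dj; apply: le_trans ds _; rewrite ler_piMl// gerBl ltW.
  - apply: le_trans Lj; apply: (le_trans (lerD vs (ler_wpM2l _ ds))).
      by rewrite divr_ge0// ?sqr_ge0// ltW.
    by rewrite le_eqVlt; apply/orP; left; apply/eqP; field; rewrite gt_eqF.
have Kg : 0 <= K ^+ 2 / g by rewrite divr_ge0 ?sqr_ge0// ltW.
apply: limr_le; first exact: var_iter_cvg.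
apply: nearW => k; have [_ _] := inv k; apply: le_trans.
rewrite -[leLHS]addr0; apply: lerD.
  by apply: var_iter_nondecreasing; rewrite -addnn leq_addr.
by rewrite (mulr_ge0 Kg)// (defect_ge0 l _ (Pd _)).
Qed.

End stability.
End orbit.

(** * Null sets and boxes for Lebesgue measure on tuples *)

Section polynomial_functions.
Context {R : realType}.

(** Closing constants and coordinates under sums and products is enough here:
    fixing some coordinates stays within the class, and with a single free
    coordinate one gets a univariate polynomial. *)
Inductive polyfun n : (Rtuple R n -> R) -> Prop :=
| polyfun_cst c : polyfun n (fun=> c)
| polyfun_coord i : polyfun n (fun t => tnth t i)
| polyfunD f g : polyfun n f -> polyfun n g -> polyfun n (fun t => f t + g t)
| polyfunM f g : polyfun n f -> polyfun n g -> polyfun n (fun t => f t * g t).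

Lemma polyfun_sum n (I : finType) (f : I -> Rtuple R n -> R) :
  (forall i, polyfun n (f i)) -> polyfun n (fun t => \sum_i f i t).
Proof.
move=> fP; elim: (index_enum I) => [|i s IHs].
  by under eq_fun do rewrite big_nil; exact: polyfun_cst.
by under eq_fun do rewrite big_cons; exact: polyfunD.
Qed.

Lemma measurable_polyfun n f : polyfun n f -> measurable_fun [set: Rtuple R n] f.
Proof.
elim=> [c|i|g h _ mg _ mh|g h _ mg _ mh].
- exact: measurable_cst.
- exact: measurable_tnth.
- exact: measurable_funD.
- exact: measurable_funM.
Qed.

Lemma tnth_tuple_consS n (x : R) (t : Rtuple R n) i :
  tnth (tuple_cons (x, t)) (lift ord0 i) = tnth t i.
Proof. by rewrite /tuple_cons tnthS. Qed.

Lemma polyfun_fix_head n f (x : R) : polyfun n.+1 f ->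
  polyfun n (fun t => f (tuple_cons (x, t))).
Proof.
elim=> [c|i|g h _ mg _ mh|g h _ mg _ mh].
- exact: polyfun_cst.
- case: (unliftP ord0 i) => [j|] ->; last exact: polyfun_cst.
  by under eq_fun do rewrite tnth_tuple_consS; exact: polyfun_coord.
- exact: polyfunD.
- exact: polyfunM.
Qed.

Lemma polyfun_fix_tail n f (t : Rtuple R n) : polyfun n.+1 f ->
  exists q : {poly R}, forall x, f (tuple_cons (x, t)) = q.[x].
Proof.
elim=> [c|i|g h _ [q gq] _ [r hr]|g h _ [q gq] _ [r hr]].
- by exists c%:P => x; rewrite hornerC.
- case: (unliftP ord0 i) => [j|] ->.
    by exists (tnth t j)%:P => x; rewrite tnth_tuple_consS hornerC.
  by exists 'X => x; rewrite hornerX.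
- by exists (q + r) => x; rewrite gq hr hornerD.
- by exists (q * r) => x; rewrite gq hr hornerM.
Qed.

Lemma finite_roots (q : {poly R}) : q != 0 -> finite_set [set x | root q x].
Proof.
have [s sE] := ubnP (size q); elim: s q sE => // s IHs q; rewrite ltnS => sq q0.
have [[a qa]|noroot] := pselect (exists a, root q a); last first.
  rewrite (_ : [set x | _] = set0)//; apply/seteqP; split=> // x /= qx.
  by apply: noroot; exists x.
have /factor_theorem[r rE] := qa.
have r0 : r != 0 by apply: contraNneq q0 => r0; rewrite rE r0 mul0r.
have sr : (size r < s)%N.
  by move: sq; rewrite rE size_Mmonic ?monicXsubC// size_XsubC addn2.
rewrite (_ : [set x | _] = [set x | root r x] `|` [set a]).
  by rewrite finite_setU; split; [exact: IHs|exact: finite_set1].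
apply/seteqP; split=> x /=.
  by rewrite rE rootM root_XsubC => /orP[|/eqP]; [left|right].
by rewrite rE rootM root_XsubC => -[->//|->]; rewrite eqxx orbT.
Qed.

Lemma measurable_polyfun_zeros n f : polyfun n f -> measurable [set t | f t = 0].
Proof.
move=> /measurable_polyfun mf; rewrite -[X in measurable X]setTI.
exact: (mf measurableT [set 0]).
Qed.

(** By induction on the dimension: [f] restricted to the slice of head [x] is not
    identically zero unless [x] is one of the finitely many roots of
    [x |-> f (x, s0)], where [s0] is the tail of a point at which [f] does not
    vanish.  So almost every slice of the zero set is null. *)
Lemma polyfun_zeros_null n f t0 : polyfun n f -> f t0 != 0 ->
  lebesgue_tuple n [set t | f t = 0] = 0%E.
Proof.
elim: n f t0 => [|n IHn] f t0 fP ft0.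
  rewrite (_ : [set t | _] = set0) ?measure0//; apply/seteqP; split=> // t /=.
  by rewrite (tuple0 t) -(tuple0 t0) => /eqP; rewrite (negPf ft0).
pose Z : set (measurableTypeR R * Rtuple R n) := @tuple_cons R n @^-1` [set t | f t = 0].
have mZ : measurable Z.
  rewrite -[X in measurable X]setTI; apply: measurable_tuple_cons => //.
  exact: measurable_polyfun_zeros.
rewrite [LHS](_ : _ = \int[lebesgue_measure]_x (lebesgue_tuple n (xsection Z x)))%E//.
pose s0 : Rtuple R n := [tuple of behead t0].
have t0E : t0 = tuple_cons (tnth t0 ord0, s0).
  by rewrite {1}(tuple_eta t0); exact/val_inj.
have [q qE] := polyfun_fix_tail n f s0 fP.
have q0 : q != 0.
  apply: contra_neq ft0 => q0; rewrite t0E qE q0 horner0 //.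
have fin := finite_roots _ q0.
have mroots : measurable ([set x | root q x] : set (measurableTypeR R)).
  exact/countable_measurable/finite_set_countable.
transitivity (\int[lebesgue_measure]_(x in [set: measurableTypeR R]) (cst 0 x : \bar R))%E.
  apply: ge0_ae_eq_integral => //; first exact: measurable_fun_xsection.
  exists [set x | root q x]; split => //.
    exact/countable_lebesgue_measure0/finite_set_countable.
  move=> x /=; apply: contra_notP => nroot _.
  have fx : f (tuple_cons (x, s0)) != 0 by rewrite qE; exact/negP.
  have := IHn _ _ (polyfun_fix_head n f x fP) fx.
  by rewrite xsectionE.
by rewrite integral_cst// mul0e.
Qed.

End polynomial_functions.

Section boxes.
Context {R : realType}.

Lemma lebesgue_tuple_box_gt0 n (x : 'I_n -> R) (r : R) : 0 < r ->
  let box := [set t : Rtuple R n | forall i, `|tnth t i - x i| < r] in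
  measurable box /\ (0 < lebesgue_tuple n box)%E.
Proof.
move=> r0 /=; elim: n x => [|n IHn] x.
  have -> : [set t : Rtuple R 0 | forall i, `|tnth t i - x i| < r] = setT.
    by apply/seteqP; split=> // t _ [].
  by split => //; rewrite [ltRHS]diracT.
have [mbox box0] := IHn (fun i => x (lift ord0 i)).
pose A : set (measurableTypeR R) := [set y : R | `|y - x ord0| < r].
have AE : A = ball (x ord0) r by apply/seteqP; split=> y; rewrite /A /ball/= distrC.
have mA : measurable A by rewrite AE; exact: measurable_ball.
set C := (X in measurable X) in mbox; set D := [set t | _].
have DE : D = [set t | A (tnth t ord0) /\ C [tuple of behead t]].
  apply/seteqP; split=> t /= h.
    by split=> [|i]; [exact: h | have := h (lift ord0 i); rewrite {1}(tuple_eta t) tnthS].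
  case: h => h0 h i; case: (unliftP ord0 i) => [j|] ->//.
  by rewrite (tuple_eta t) tnthS.
split; last first.
  rewrite DE lebesgue_tupleS// mule_gt0// AE lebesgue_measure_ball ?ltW//.
  by rewrite lte_fin mulrn_wgt0.
rewrite (_ : D = (@tnth _ _ ^~ ord0 @^-1` A) `&`
  ((fun t : Rtuple R n.+1 => [tuple of behead t] : Rtuple R n) @^-1` C)); last by rewrite DE.
apply: measurableI; rewrite -[X in measurable X]setTI.
  exact: measurable_tnth.
exact: measurable_behead.
Qed.

End boxes.

(** * Rate of convergence of the descent method *)

Section asymptotics.
Context {R : realType}.
Implicit Types (u v N f : R^nat).

Lemma bounded_over_n u (C : R) : (forall k, `|u k| <= C) ->
  k%:R^-1 * u k @[k --> \oo] --> 0.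
Proof.
move=> uC; have hC : C * harmonic k @[k --> \oo] --> (0 : R).
  by rewrite -(mulr0 C); apply: cvgM; [exact: cvg_cst|exact: cvg_harmonic].
apply/norm_cvg0P; rewrite -cvg_shiftS.
apply: (squeeze_cvgr _ (cvg_cst 0) hC); apply: nearW => k /=.
by rewrite normr_ge0/= normrM mulrC ler_pM// ger0_norm.
Qed.

(** Only the two-step increments converge, so Cesaro's lemma is applied to the
    averages [(u k + u k.+1) / 2], whose increments are half of these. *)
Lemma growth_rate_two_step u v (C a : R) :
    u k.+2 - u k @[k --> \oo] --> 2 * a ->
    (forall k, `|u k.+1 - u k| <= C) -> (forall k, `|v k - u k| <= C) ->
  k%:R^-1 * v k @[k --> \oo] --> a.
Proof.
move=> u2 uC vC.
pose B k := (u k + u k.+1) / 2.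
have dB : telescope B @ \oo --> a.
  apply: (eq_cvgn (cvgM (cvg_cst (2^-1 : R)) u2)); last by field.
  by move=> k; rewrite /telescope /B /=; field.
have mB : k.+1%:R^-1 * (B k.+1 - B 0%N) @[k --> \oo] --> a.
  apply: (eq_cvgn (cesaro dB)) => // k.
  by rewrite /arithmetic_mean /= telescopeK.
have rest : k%:R^-1 * (v k - B k + B 0%N) @[k --> \oo] --> 0.
  apply: (bounded_over_n _ (2 * C + `|B 0%N|)) => k.
  apply: (le_trans (ler_normD _ _)); rewrite lerD2r.
  rewrite (_ : v k - B k = (v k - u k) - 2^-1 * (u k.+1 - u k)); last first.
    by rewrite /B; field.
  apply: (le_trans (ler_normB _ _)); rewrite normrM ger0_norm//.
  have := uC k; have := vC k; have := normr_ge0 (u k.+1 - u k); lra.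
rewrite -cvg_shiftS; rewrite -cvg_shiftS in rest.
apply: (eq_cvgn (cvgD mB rest)) => [k /=|]; last by rewrite addr0.
by rewrite fctE -mulrDr; congr (_ * _); ring.
Qed.

Lemma ln_bounded (a b r : R) : 0 < a -> a <= r <= b -> `|ln r| <= `|ln a| + `|ln b|.
Proof.
move=> a0 /andP[ar rb]; have r0 := lt_le_trans a0 ar; have b0 := lt_le_trans r0 rb.
have h1 : ln a <= ln r by rewrite ler_ln.
have h2 : ln r <= ln b by rewrite ler_ln.
have := ler_norm (ln b); have := ler_norm (- ln a); rewrite normrN.
have := normr_ge0 (ln a); have := normr_ge0 (ln b).
by move=> *; rewrite ler_norml; apply/andP; split; lra.
Qed.

(** The logarithmic form of this statement is [growth_rate_two_step]; comparing
    [f] with [N] lets one follow the energy through the gradient norm. *)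
Lemma root_rate_two_step N f (a b c d L : R) :
    (forall k, 0 < N k) -> 0 < a -> 0 < c -> 0 < L ->
    (forall k, a <= N k.+1 / N k <= b) -> (forall k, c <= f k / N k <= d) ->
    N k.+2 / N k @[k --> \oo] --> L ^+ 2 ->
  (Num.sqrt (f k / f 0%N)) `^ (k%:R^-1) @[k --> \oo] --> Num.sqrt L.
Proof.
move=> N0 a0 c0 L0 Nab fcd NL.
have f0 k : 0 < f k.
  have /andP[h _] := fcd k; have := lt_le_trans c0 h.
  by rewrite pmulr_lgt0 ?invr_gt0.
have lnd (x y : R) : 0 < x -> 0 < y -> ln x - ln y = ln (x / y).
  by move=> x0 y0; rewrite lnM ?posrE ?invr_gt0// lnV ?posrE.
pose u k := ln (N k); pose v k := ln (f k / f 0%N).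
pose C := (`|ln a| + `|ln b|) + (`|ln c| + `|ln d|) + `|ln (f 0%N)|.
have u2 : u k.+2 - u k @[k --> \oo] --> 2 * ln L.
  have L20 : 0 < L ^+ 2 by rewrite exprn_gt0.
  apply: (eq_cvgn (continuous_cvg _ (continuous_ln L20) NL)) => [k /=|].
    by rewrite lnd.
  by rewrite lnXn// mulr_natl.
have vu : k%:R^-1 * v k @[k --> \oo] --> ln L.
  apply: (growth_rate_two_step u v C) => // k.
    rewrite lnd//; apply: le_trans (ln_bounded _ _ _ a0 (Nab k)) _.
    by rewrite /C -addrA lerDl addr_ge0// addr_ge0.
  rewrite /v /u -lnd// addrAC lnd//; apply: le_trans (ler_normB _ _) _.
  apply: lerD => //; apply: le_trans (ln_bounded _ _ _ c0 (fcd k)) _.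
  by rewrite lerDr addr_ge0.
have cv : expR (2^-1 * (k%:R^-1 * v k)) @[k --> \oo] --> expR (2^-1 * ln L).
  apply: (continuous_cvg _ (@continuous_expR R _)).
  exact: (cvgM (cvg_cst (2^-1 : R)) vu).
apply: (eq_cvgn cv) => [k|].
  rewrite -powR12_sqrt ?divr_ge0 ?ltW// -powRrM /powR gt_eqF ?divr_gt0//.
  by rewrite mulrA.
by rewrite -powR12_sqrt ?ltW// /powR gt_eqF.
Qed.

End asymptotics.

Section diagonal.
Context {R : realType} {n : nat}.
Implicit Types (d : 'rV[R]_n) (x : 'cV[R]_n).

Lemma diag_mx_expr_mul d k x :
  diag_mx d ^+ k *m x = \col_i (d 0 i ^+ k * x i 0).
Proof.
elim: k => [|k IHk]; apply/matrixP => i j; rewrite (ord1 j) mxE.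
  by rewrite expr0 mul1mx mul1r.
by rewrite exprS -mulmxA IHk mul_diag_mx !mxE mulrA -exprS.
Qed.

Lemma quad_diag d k x : quad (diag_mx d ^+ k) x = \sum_i d 0 i ^+ k * x i 0 ^+ 2.
Proof.
rewrite /quad -mulmxA diag_mx_expr_mul mxE; apply: eq_bigr => i _.
by rewrite !mxE mulrCA expr2.
Qed.

End diagonal.

Section weights.
Context {R : realType} {I : finType}.
Implicit Types g : I -> R.

Definition sqr_norm g : R := \sum_i g i ^+ 2.
Definition weights g : I -> R := fun i => g i ^+ 2 / sqr_norm g.

Lemma sqr_norm_ge0 g : 0 <= sqr_norm g.
Proof. by apply: sumr_ge0 => i _; exact: sqr_ge0. Qed.

Lemma sqr_norm_gt0 g i : g i != 0 -> 0 < sqr_norm g.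
Proof.
move=> gi; rewrite /sqr_norm (bigD1 i)//= ltr_pwDl ?exprn_even_gt0//.
by apply: sumr_ge0 => j _; exact: sqr_ge0.
Qed.

Lemma weights_dist g : 0 < sqr_norm g -> is_dist (weights g).
Proof.
move=> g0; split=> [i|]; first by rewrite divr_ge0 ?sqr_ge0 ?sqr_norm_ge0.
by rewrite -mulr_suml divff// gt_eqF.
Qed.

Lemma weights_gt0 g i : (0 < weights g i) = (g i != 0).
Proof.
have [gi|gi] := eqVneq (g i) 0; first by rewrite /weights gi expr0n/= mul0r ltxx.
by rewrite divr_gt0 ?exprn_even_gt0//; exact: sqr_norm_gt0 gi.
Qed.

Lemma weights_two_sided g top bot : g top != 0 -> g bot != 0 ->
  two_sided top bot (weights g).
Proof.
move=> gt gb; split; rewrite ?weights_gt0//.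
by apply: weights_dist; exact: sqr_norm_gt0 gt.
Qed.

Lemma weightsZ (s : R) g : s != 0 -> weights (fun i => s * g i) = weights g.
Proof.
move=> s0; apply/funext => i; rewrite /weights /sqr_norm.
under eq_bigr do rewrite exprMn.
by rewrite -mulr_sumr exprMn -mulf_div divff ?mul1r// expf_neq0.
Qed.

Lemma expect_weights g f : expect (weights g) f = (\sum_i g i ^+ 2 * f i) / sqr_norm g.
Proof. by rewrite /expect mulr_suml; apply: eq_bigr => i _; rewrite mulrAC. Qed.

End weights.

Section descent.
Context {R : realType} {n : nat} (lambda : 'rV[R]_n) (l : 'I_n -> R) (top bot : 'I_n).
Context (H c : R).
Hypothesis H_gt0 : 0 < H.
Hypothesis c_gt1 : 1 < c.
Hypothesis l_bound : forall i, `|l i| <= 1.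
Hypothesis l_top : l top = 1.
Hypothesis l_bot : l bot = -1.
Hypothesis lambdaE : forall i, lambda 0 i = H * (c + l i).

Let A := diag_mx lambda.

Definition gradient (x : 'cV[R]_n) : 'I_n -> R := fun i => lambda 0 i * x i 0.

Let lambda_bounds i : H * (c - 1) <= lambda 0 i <= H * (c + 1).
Proof.
have := l_bound i; rewrite ler_norml => /andP[h1 h2].
by rewrite lambdaE !ler_pM2l//; apply/andP; split; lra.
Qed.

Let lambda_min_gt0 : 0 < H * (c - 1).
Proof. by rewrite mulr_gt0// subr_gt0. Qed.

Let lambda_gt0 i : 0 < lambda 0 i.
Proof. by have /andP[+ _] := lambda_bounds i; exact: lt_le_trans. Qed.

Let quad2E x : quad (A ^+ 2) x = sqr_norm (gradient x).
Proof. by rewrite quad_diag; apply: eq_bigr => i _; rewrite exprMn. Qed.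

Let quad1E x : quad A x = \sum_i lambda 0 i * x i 0 ^+ 2.
Proof. by rewrite -{1}[A]expr1 quad_diag; under eq_bigr do rewrite expr1. Qed.

Let cD1_gt0 : 0 < c + 1. Proof. by have := c_gt1; lra. Qed.
Let cB1_gt0 : 0 < c - 1. Proof. by rewrite subr_gt0. Qed.

Section one_step.
Context (x : 'cV[R]_n).
Let g := gradient x.
Hypothesis g_two : two_sided top bot (weights g).
Let m := mean l (weights g).
Let V := var l (weights g).
Let N := sqr_norm g.

Let N_gt0 : 0 < N.
Proof. by case: g_two => _; rewrite weights_gt0 => /sqr_norm_gt0. Qed.

Let g_dist : is_dist (weights g). Proof. by case: g_two. Qed.

Let cm_gt0 : 0 < c + m.
Proof.
have : `|m| <= 1 := mean_norm_le1 l _ g_dist l_bound.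
by rewrite ler_norml => /andP[h _]; have := c_gt1; lra.
Qed.

Let x_neq0 : x != 0.
Proof.
apply/negP => /eqP x0; move: N_gt0; rewrite /N /sqr_norm big1 ?ltxx// => i _.
by rewrite /g /gradient x0 mxE mulr0 expr0n.
Qed.

Let quad3E : quad (A ^+ 3) x = N * (H * (c + m)).
Proof.
rewrite quad_diag /m /mean expect_weights -/N.
rewrite (_ : N * _ = H * (c * N + \sum_i g i ^+ 2 * l i)); last first.
  by field; rewrite gt_eqF.
rewrite /N /sqr_norm mulr_sumr -big_split mulr_sumr; apply: eq_bigr => i _ /=.
by rewrite /g /gradient lambdaE; ring.
Qed.

Lemma quad_gt0 : 0 < quad A x.
Proof.
rewrite quad1E; case: g_two => _; rewrite weights_gt0 => gt _.
rewrite (bigD1 top)//= ltr_pwDl//.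
  rewrite mulr_gt0// exprn_even_gt0//=; apply: contraNneq gt => x0.
  by rewrite /g /gradient x0 mulr0.
by apply: sumr_ge0 => i _; rewrite mulr_ge0 ?sqr_ge0// ltW.
Qed.

Let ogdE i : ogd A x i 0 = (m - l i) / (c + m) * x i 0.
Proof.
rewrite /ogd (negPf x_neq0) quad3E quad2E -/g -/N 3!mxE.
have -> : (A *m x) i 0 = lambda 0 i * x i 0 by rewrite mul_diag_mx mxE.
rewrite lambdaE; field.
by rewrite !gt_eqF.
Qed.

(** The exact line search decreases the energy [x^T A x] by
    [(x^T A^2 x) ^ 2 / (x^T A^3 x)], so the shrinking factors telescope. *)
Lemma shrinking_factorE : shrinking_factor A x = Num.sqrt (quad A (ogd A x) / quad A x).
Proof.
rewrite /shrinking_factor (negPf x_neq0); congr Num.sqrt.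
have q0 := quad_gt0; rewrite quad3E quad2E -/g -/N.
have -> : quad A (ogd A x) = quad A x - N / (H * (c + m)).
  have s3 := quad3E; rewrite quad_diag in s3.
  have s2 := quad2E x; rewrite quad_diag -/g -/N in s2.
  set t := (H * (c + m))^-1.
  have -> : quad A x - N * t = quad A x - 2 * t * N + t ^+ 2 * (N * (H * (c + m))).
    by rewrite /t; field; rewrite gt_eqF// gt_eqF.
  rewrite -s3 -s2 !quad1E 2!mulr_sumr -sumrB -big_split; apply: eq_bigr => i _ /=.
  rewrite ogdE.
  have -> : (m - l i) / (c + m) = 1 - t * lambda 0 i.
    by rewrite /t lambdaE; field; rewrite !gt_eqF.
  by ring.
by field; rewrite !gt_eqF.
Qed.

Lemma gradient_ogd i : gradient (ogd A x) i = (m - l i) / (c + m) * g i.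
Proof. by rewrite /gradient ogdE mulrCA. Qed.

Lemma sqr_norm_ogd : sqr_norm (gradient (ogd A x)) = N * (V / (c + m) ^+ 2).
Proof.
rewrite /V /var expect_weights -/N.
rewrite (_ : N * _ = \sum_i g i ^+ 2 * (l i - m) ^+ 2 / (c + m) ^+ 2); last first.
  by rewrite -mulr_suml; field; rewrite !gt_eqF.
apply: eq_bigr => i _; rewrite gradient_ogd; field.
by rewrite gt_eqF.
Qed.

Lemma weights_ogd : weights (gradient (ogd A x)) = reweight l (weights g).
Proof.
have V0 : 0 < V := two_sided_var_gt0 l top bot l_top l_bot _ g_two.
apply/funext => i; rewrite /weights sqr_norm_ogd gradient_ogd /reweight -/m -/V.
rewrite /weights -/N; field.
by rewrite !gt_eqF.
Qed.

Lemma quad_sqr_norm :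
  (H * (c + 1))^-1 <= quad A x / sqr_norm g <= (H * (c - 1))^-1.
Proof.
have cp : 0 < H * (c + 1) by rewrite mulr_gt0.
rewrite ler_pdivlMr// ler_pdivrMr// ler_pdivrMl// ler_pdivlMl//.
rewrite /sqr_norm quad1E !mulr_sumr; apply/andP; split; apply: ler_sum => i _;
  have /andP[h1 h2] := lambda_bounds i; rewrite exprMn expr2 -[_ * lambda 0 i * _]mulrA.
  by rewrite ler_wpM2r// mulr_ge0 ?sqr_ge0// ltW.
by rewrite ler_wpM2r// mulr_ge0 ?sqr_ge0// ltW.
Qed.

End one_step.

(** The product of the first [k] shrinking factors is [sqrt (f k / f 0)] with [f]
    the energy.  The energy is comparable with the squared gradient norm [N],
    and over two steps [N] is multiplied by
    [V_k V_(k+1) / ((c + m_k) (c + m_(k+1))) ^ 2], whose limit is the square of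
    [V / (c ^ 2 - 1 + V)]. *)
Theorem ogd_rateE x : two_sided top bot (weights (gradient x)) ->
  let V := limit_var l (weights (gradient x)) in
  ogd_rate A x = (Num.sqrt (V / (c ^+ 2 - 1 + V)))%:E.
Proof.
move=> x2; set p := weights (gradient x) in x2 *; set V := limit_var l p.
pose X k := iter k (ogd A) x.
pose P k := iter k (reweight l) p.
have wX k : weights (gradient (X k)) = P k.
  elim: k => // k IHk; rewrite /X /P !iterS -/(X k) -/(P k) -IHk.
  by apply: weights_ogd; rewrite IHk; exact: two_sided_iter.
have P2 k : two_sided top bot (P k) by exact: two_sided_iter.
have X2 k : two_sided top bot (weights (gradient (X k))) by rewrite wX.
pose N k := sqr_norm (gradient (X k)).
pose f k := quad A (X k).
pose vv k := var l (P k); pose mm k := mean l (P k).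
have N0 k : 0 < N k by case: (X2 k) => _; rewrite weights_gt0 => /sqr_norm_gt0.
have f0 k : 0 < f k by exact: quad_gt0.
have NS k : N k.+1 / N k = vv k / (c + mm k) ^+ 2.
  rewrite /N /X iterS -/(X k) sqr_norm_ogd// wX -/(vv k) -/(mm k) -/(N k).
  by rewrite mulrC mulKf// gt_eqF.
have prodE k : \prod_(j < k) shrinking_factor A (X j) = Num.sqrt (f k / f 0%N).
  elim: k => [|k IHk]; first by rewrite big_ord0 divff ?sqrtr1// gt_eqF.
  rewrite big_ord_recr/= IHk shrinking_factorE// -sqrtrM ?divr_ge0 ?(ltW (f0 _))//.
  rewrite -[ogd A (X k)]/(X k.+1) -/(f k) -/(f k.+1); congr Num.sqrt.
  by field; rewrite !gt_eqF.
have V0 : 0 < V := limit_var_gt0 l top bot l_bound l_top l_bot p x2.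
have c2 : 0 < c ^+ 2 - 1 + V by rewrite addr_gt0// subr_gt0 expr_gt1// ltW// (lt_trans _ c_gt1).
have vcvg : vv @ \oo --> V := var_iter_cvg l top bot l_bound l_top l_bot p x2.
have pcvg : (c + mm k) * (c + mm k.+1) @[k --> \oo] --> c ^+ 2 - 1 + V :=
  shifted_prod_cvg l top bot l_bound l_top l_bot p x2 c.
have mm_bd k : c - 1 <= c + mm k <= c + 1.
  have [Pd _ _] := P2 k.
  have := mean_norm_le1 l _ Pd l_bound; rewrite -/(mm k) ler_norml => /andP[h1 h2].
  by apply/andP; split; lra.
have cmm0 k : 0 < c + mm k.
  by have /andP[+ _] := mm_bd k; apply: lt_le_trans; rewrite subr_gt0.
have vv0 k : 0 < vv k by apply: (two_sided_var_gt0 l top bot).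
have NNS k : N k.+2 / N k = vv k * vv k.+1 / ((c + mm k) * (c + mm k.+1)) ^+ 2.
  rewrite (_ : _ / _ = (N k.+2 / N k.+1) * (N k.+1 / N k)); last first.
    by field; rewrite !gt_eqF.
  by rewrite !NS; field; rewrite !gt_eqF.
have root_cvg : (Num.sqrt (f k / f 0%N)) `^ (k%:R^-1) @[k --> \oo] -->
    Num.sqrt (V / (c ^+ 2 - 1 + V)).
  apply: (root_rate_two_step N f (vv 0%N / (c + 1) ^+ 2) (1 / (c - 1) ^+ 2)
    (H * (c + 1))^-1 (H * (c - 1))^-1) => //.
  - by rewrite divr_gt0// exprn_gt0.
  - by rewrite invr_gt0 mulr_gt0.
  - exact: divr_gt0.
  - move=> k; rewrite NS; have /andP[b1 b2] := mm_bd k.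
    have v1 : vv k <= 1 by case: (P2 k) => Pd _ _; exact: (var_le1 l _ Pd l_bound).
    have v0 : vv 0%N <= vv k.
      exact: (var_iter_nondecreasing l top bot l_bound l_top l_bot p x2 0%N k (leq0n k)).
    have q1 : (c - 1) ^+ 2 <= (c + mm k) ^+ 2.
      by rewrite ler_pXn2r// nnegrE ltW.
    have q2 : (c + mm k) ^+ 2 <= (c + 1) ^+ 2.
      by rewrite ler_pXn2r// nnegrE ltW.
    apply/andP; split.
      rewrite ler_pM// ?(ltW (vv0 _))// ?invr_ge0 ?exprn_ge0 ?(ltW cD1_gt0)//.
      by rewrite lef_pV2// posrE exprn_gt0.
    rewrite ler_pM// ?(ltW (vv0 _))// ?invr_ge0 ?exprn_ge0 ?(ltW (cmm0 _))//.
    by rewrite lef_pV2// posrE exprn_gt0.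
  - by move=> k; exact: quad_sqr_norm.
  have vS : vv k.+1 @[k --> \oo] --> V by rewrite cvg_shiftS.
  have q0 : (c ^+ 2 - 1 + V) * (c ^+ 2 - 1 + V) != 0 by rewrite mulf_neq0 ?gt_eqF.
  apply: (eq_cvgn (cvgM (cvgM vcvg vS) (cvgV q0 (cvgM pcvg pcvg)))) => [k|].
    by rewrite NNS expr2.
  by field; rewrite gt_eqF.
set L := Num.sqrt _ in root_cvg *.
have ecvg : ((Num.sqrt (f k / f 0%N)) `^ (k%:R^-1))%:E @[k --> \oo] --> L%:E.
  by apply: cvg_EFin => //; exact: nearW.
rewrite /ogd_rate; under eq_fun do rewrite prodE.
rewrite is_cvg_limn_esupE; first exact/cvg_lim.
by apply/cvg_ex; exists L%:E.
Qed.

End descent.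

(** * Generic starting points *)

Section polynomial_iterates.
Context {R : realType} {I : finType} (l : I -> R).

(** A step of the method freed from its denominators: it yields the new gradient up to
    a scalar, hence the same weights, and its entries are polynomials in the
    starting point. *)
Definition poly_step (g : I -> R) : I -> R :=
  fun i => (\sum_j g j ^+ 2 * (l j - l i)) * g i.

Lemma poly_stepE g i : 0 < sqr_norm g ->
  poly_step g i = sqr_norm g * (mean l (weights g) - l i) * g i.
Proof.
move=> g0; rewrite /poly_step /mean expect_weights; congr (_ * _).
rewrite mulrBr mulrC divfK ?gt_eqF// /sqr_norm mulr_suml -sumrB.
by apply: eq_bigr => j _; rewrite mulrBr.
Qed.

Lemma weights_poly_step g : 0 < sqr_norm g -> 0 < var l (weights g) ->
  weights (poly_step g) = reweight l (weights g).
Proof.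
move=> g0 V0; set V := var l (weights g) in V0 *; set m := mean l (weights g).
have sE : sqr_norm (poly_step g) = sqr_norm g ^+ 3 * V.
  rewrite /V /var expect_weights -/m.
  rewrite (_ : _ * (_ / _) = sqr_norm g ^+ 2 * \sum_i g i ^+ 2 * (l i - m) ^+ 2).
    rewrite mulr_sumr; apply: eq_bigr => i _; rewrite poly_stepE// -/m; ring.
  by field; rewrite gt_eqF.
apply/funext => i; rewrite /weights sE poly_stepE// -/m /reweight -/m -/V /weights.
by field; rewrite !gt_eqF.
Qed.

Lemma poly_stepZ s g : poly_step (fun i => s * g i) = fun i => s ^+ 3 * poly_step g i.
Proof.
apply/funext => i; rewrite /poly_step.
under eq_bigr do rewrite exprMn -mulrA.
by rewrite -mulr_sumr; ring.
Qed.

Lemma iter_poly_stepZ k s g :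
  iter k poly_step (fun i => s * g i) = fun i => s ^+ (3 ^ k) * iter k poly_step g i.
Proof.
elim: k => [|k IHk]; first by rewrite expn0 expr1.
by rewrite iterS IHk poly_stepZ -exprM -expnSr.
Qed.

Lemma weights_iter_poly_step top bot g k : (forall i, `|l i| <= 1) ->
    l top = 1 -> l bot = -1 -> two_sided top bot (weights g) ->
  weights (iter k poly_step g) = iter k (reweight l) (weights g).
Proof.
move=> lb lt l_b g2; elim: k => // k IHk.
have g2k : two_sided top bot (weights (iter k poly_step g)).
  by rewrite IHk; exact: two_sided_iter.
rewrite !iterS -IHk weights_poly_step//; last first.
  exact: (two_sided_var_gt0 l top bot).
by case: g2k => _; rewrite weights_gt0 => /sqr_norm_gt0.
Qed.

(** In the sum defining [poly_step] only the other node of the pair contributes,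
    through a nonzero square times [l a - l b] up to sign. *)
Lemma iter_poly_step_pair a b g k : l a != l b ->
  (forall i, (g i != 0) = (i \in [:: a; b])) ->
  forall i, (iter k poly_step g i != 0) = (i \in [:: a; b]).
Proof.
move=> lab; elim: k => // k IHk gab i; rewrite iterS.
set h := iter k poly_step g; have hab : forall i, (h i != 0) = (i \in [:: a; b]) := IHk gab.
have ab : a != b by apply: contraNneq lab => ->.
have h0 j : j != a -> j != b -> h j = 0.
  by move=> ja jb; apply/eqP; rewrite -[_ == _]negbK hab !inE (negPf ja) (negPf jb).
have ha : h a != 0 by rewrite hab !inE eqxx.
have hb : h b != 0 by rewrite hab !inE eqxx orbT.
have sumE : \sum_j h j ^+ 2 * (l j - l i) = h a ^+ 2 * (l a - l i) + h b ^+ 2 * (l b - l i).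
  rewrite (bigD1 a)//= (bigD1 b) 1?eq_sym//= big1 ?addr0// => j /andP[ja jb].
  by rewrite h0// expr0n mul0r.
rewrite /poly_step sumE mulf_eq0 negb_or hab.
have [iab|] := boolP (i \in _); last by rewrite andbF.
rewrite andbT; move: iab; rewrite !inE => /orP[]/eqP ->.
  by rewrite subrr mulr0 add0r mulf_neq0 ?expf_neq0// subr_eq0 eq_sym.
by rewrite subrr mulr0 addr0 mulf_neq0 ?expf_neq0// subr_eq0.
Qed.

End polynomial_iterates.

Lemma polyfun_iter_poly_step {R : realType} {n : nat} (I : finType) (l : I -> R)
    (g : Rtuple R n -> I -> R) k i :
  (forall j, polyfun n (g^~ j)) -> polyfun n (fun t => iter k (poly_step l) (g t) i).
Proof.
move=> gP; elim: k i => [|k IHk] i; first exact: gP.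
apply: polyfunM; last exact: IHk.
apply: polyfun_sum => j; apply: polyfunM; last exact: polyfun_cst.
by under eq_fun do rewrite expr2; apply: polyfunM; exact: IHk.
Qed.

Lemma cvg_fin_sum {R : realType} (T : Type) (F : set_system T) {FF : Filter F}
    (I : finType) (f : I -> T -> R) (a : I -> R) :
  (forall i, f i x @[x --> F] --> a i) -> \sum_i f i x @[x --> F] --> \sum_i a i.
Proof.
move=> fa; elim: (index_enum I) => [|i r IHr].
  rewrite big_nil (_ : (fun=> _) = cst 0); first exact: cvg_cst.
  by apply/funext => x; rewrite big_nil.
rewrite big_cons (_ : (fun=> _) = fun x => f i x + \sum_(j <- r) f j x).
  exact: cvgD (fa i) IHr.
by apply/funext => x; rewrite big_cons.
Qed.

Section sphere_almost_everywhere.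
Context {R : realType} {n : nat}.

(** The sphere measure is a normalized cone measure, so its null sets are read on
    the punctured ball. *)
Lemma sphere_measure_null (E : set (Rtuple R n.+1)) :
  sphere_measure R n.+1 E = 0%E <->
  lebesgue_tuple n.+1 (@punctured_ball R n.+1 `&` @normalize R n.+1 @^-1` E) = 0%E.
Proof.
rewrite /sphere_measure; split=> [|->]; last by rewrite mule0.
have := @punctured_ball_gt0 R n.+1 isT; have := @punctured_ball_lty R n.+1.
case: (lebesgue_tuple _ _) => // r _; rewrite lte_fin => r0 /=.
by move/eqP; rewrite mule_eq0 eqe invr_eq0 gt_eqF//= => /eqP.
Qed.

(** The last hypothesis says that the zero set of [f] away from the origin is a
    cone; the cone over its trace on the sphere is then null with it. *)
Lemma sphere_ae_polyfun f t0 : polyfun n.+1 f -> f t0 != 0 ->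
    (forall t, 0 < euclidean_norm t -> f (normalize t) = 0 -> f t = 0) ->
  \forall t \ae sphere_measure R n.+1, f t != 0.
Proof.
move=> fP ft0 f_cone; exists [set t | f t = 0]; split.
- exact: measurable_polyfun_zeros.
- apply/sphere_measure_null; apply: (@subset_measure0 _ _ _ _ _ [set t | f t = 0]).
  + apply: measurableI; first exact: measurable_punctured_ball.
    rewrite -[X in measurable X]setTI; apply: measurable_normalize => //.
    exact: measurable_polyfun_zeros.
  + exact: measurable_polyfun_zeros.
  + by move=> t [/andP[t0' _]] /=; exact: f_cone.
  + exact: polyfun_zeros_null fP ft0.
- by move=> t /= /negP; rewrite negbK => /eqP.
Qed.

Definition col_of_tuple (t : Rtuple R n.+1) : 'cV[R]_n.+1 := \col_i (tnth t i : R).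

(** A neighbourhood of a point of the open unit ball contains a box inside the
    punctured ball, which has positive volume; so it cannot project into the
    null set where [Q] fails. *)
Lemma sphere_ae_open (Q : Rtuple R n.+1 -> Prop) (W : set 'cV[R]_n.+1) (x : 'cV[R]_n.+1) :
    x != 0 -> \sum_i x i 0 ^+ 2 < 1 -> nbhs x W ->
    (\forall t \ae sphere_measure R n.+1, Q t) ->
  exists t, [/\ 0 < euclidean_norm t, W (col_of_tuple t) & Q (normalize t)].
Proof.
move=> x0 x1 xW [M [mM M0 QM]].
pose s (y : 'cV[R]_n.+1) := \sum_i y i 0 ^+ 2.
have s_gt0 : 0 < s x.
  have s0 : 0 <= s x by apply: sumr_ge0 => i _; exact: sqr_ge0.
  rewrite lt_neqAle s0 andbT eq_sym.
  apply: contraNN x0 => /eqP /psumr_eq0P sx; apply/eqP/matrixP => i j.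
  rewrite (ord1 j) mxE; apply/eqP; rewrite -sqrf_eq0; apply/eqP; apply: sx => //.
  by move=> k _; exact: sqr_ge0.
have scont : s y @[y --> x] --> s x.
  apply: (@cvg_fin_sum R _ (nbhs x) (nbhs_filter x)) => i.
  under eq_fun do rewrite expr2; rewrite expr2.
  by apply: cvgM; exact: coord_continuous.
have : \forall y \near x, [/\ W y, 0 < s y & s y < 1].
  near=> y; split; first by near: y.
    by near: y; exact: (cvgr_gt _ scont).
  by near: y; exact: (cvgr_lt _ scont).
move=> /nbhs_ballP[r /= r0 xr].
have [mbox box0] := lebesgue_tuple_box_gt0 n.+1 (fun i => x i 0) r r0.
set box := [set t | _] in mbox box0.
have boxW t : box t -> [/\ W (col_of_tuple t), 0 < s (col_of_tuple t) & s (col_of_tuple t) < 1].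
  move=> bt; apply: xr; split=> // i j; rewrite (ord1 j) /ball /= mxE distrC.
  exact: bt.
have normE t : euclidean_norm t = Num.sqrt (s (col_of_tuple t)).
  by congr Num.sqrt; apply: eq_bigr => i _; rewrite mxE.
apply: contrapT => noQ.
have : lebesgue_tuple n.+1 box = 0%E.
  apply: (@subset_measure0 _ _ _ _ _ (@punctured_ball R n.+1 `&` @normalize R n.+1 @^-1` M)) => //.
  - apply: measurableI; first exact: measurable_punctured_ball.
    by rewrite -[X in measurable X]setTI; exact: measurable_normalize.
  - move=> t /boxW[Wt t0 t1]; have nt0 : 0 < euclidean_norm t by rewrite normE sqrtr_gt0.
    split; first by rewrite /punctured_ball/= nt0/= normE -sqrtr1 ler_wsqrtr// ltW.
    by apply: QM => Qt; apply: noQ; exists t.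
  - exact/sphere_measure_null.
by move=> b0; rewrite b0 ltxx in box0.
Unshelve. all: by end_near. Qed.

End sphere_almost_everywhere.

(** * The essential infimum *)

Lemma exists_pos_lower_bound {R : realType} (I : finType) (f : I -> R) :
  exists2 g, 0 < g & forall i, 0 < f i -> g <= f i.
Proof.
suff [g g0 gf] : exists2 g, 0 < g & forall i, i \in enum I -> 0 < f i -> g <= f i.
  by exists g => // i; apply: gf; rewrite mem_enum.
elim: (enum I) => [|i s [g g0 gf]]; first by exists 1.
have [fi|fi] := ltP 0 (f i).
  exists (Num.min g (f i)); first by rewrite lt_min g0.
  move=> j; rewrite inE => /orP[/eqP ->|js fj]; first by rewrite ge_min lexx orbT.
  by rewrite ge_min gf.
exists g => // j; rewrite inE => /orP[/eqP ->|]; last exact: gf.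
by move=> /(le_lt_trans fi); rewrite ltxx.
Qed.

Section essential_infimum.
Context {R : realType} {n : nat} (lambda : 'rV[R]_n.+1) (l : 'I_n.+1 -> R).
Context (top bot : 'I_n.+1) (H c : R).
Hypothesis H_gt0 : 0 < H.
Hypothesis c_gt1 : 1 < c.
Hypothesis l_bound : forall i, `|l i| <= 1.
Hypothesis l_top : l top = 1.
Hypothesis l_bot : l bot = -1.
Hypothesis lambdaE : forall i, lambda 0 i = H * (c + l i).

Let rate (t : Rtuple R n.+1) := ogd_rate (diag_mx lambda) (\col_i (tnth t i : R)).
Let grad (t : Rtuple R n.+1) := gradient lambda (col_of_tuple t).

Definition rate_of_var (v : R) : R := Num.sqrt (v / (c ^+ 2 - 1 + v)).

Let c2_gt0 : 0 < c ^+ 2 - 1.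
Proof. by rewrite subr_gt0 expr_gt1// ltW// (lt_trans _ c_gt1). Qed.

Let den_gt0 v : 0 < v -> 0 < c ^+ 2 - 1 + v. Proof. exact: addr_gt0. Qed.

Lemma rate_of_var_le v w : 0 < v -> v <= w -> rate_of_var v <= rate_of_var w.
Proof.
move=> v0 vw; have w0 := lt_le_trans v0 vw; rewrite ler_wsqrtr//.
rewrite ler_pdivrMr ?den_gt0// mulrAC ler_pdivlMr ?den_gt0//.
by rewrite mulrDr [leRHS]mulrDr [w * v]mulrC lerD2r ler_wpM2r// ltW.
Qed.

Let lambda_neq0 i : lambda 0 i != 0.
Proof.
have := l_bound i; rewrite ler_norml lambdaE => /andP[h _].
by rewrite mulf_neq0 ?gt_eqF//; have := c_gt1; lra.
Qed.

Let gradE t i : grad t i = lambda 0 i * tnth t i.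
Proof. by rewrite /grad /gradient mxE. Qed.

Let grad_normalize t : grad (normalize t) = fun i => (euclidean_norm t)^-1 * grad t i.
Proof. by apply/funext => i; rewrite !gradE tnth_mktuple; ring. Qed.

Let grad_polyfun i : polyfun n.+1 (grad^~ i).
Proof.
under eq_fun do rewrite gradE.
by apply: polyfunM; [exact: polyfun_cst|exact: polyfun_coord].
Qed.

Let ae_coord i : \forall t \ae sphere_measure R n.+1, grad t i != 0.
Proof.
apply: (sphere_ae_polyfun (grad^~ i) [tuple 1 | _ < n.+1]) => [//||t t0].
  by rewrite gradE tnth_mktuple mulr1.
rewrite grad_normalize => /eqP; rewrite mulf_eq0 invr_eq0 (gt_eqF t0)/=.
by move=> /eqP.
Qed.

Lemma rate_lower_bound i : `|l i| < 1 ->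
  \forall t \ae sphere_measure R n.+1, ((rate_of_var ((1 - l i ^+ 2) / 2))%:E <= rate t)%E.
Proof.
move=> li1.
have l_ne : l top != l i by rewrite l_top; apply: contraTneq li1 => <-; rewrite normr1 ltxx.
have alive k : \forall t \ae sphere_measure R n.+1, iter k (poly_step l) (grad t) i != 0.
  pose t0 : Rtuple R n.+1 := [tuple (j \in [:: top; i])%:R | j < n.+1].
  apply: (sphere_ae_polyfun (fun t => iter k (poly_step l) (grad t) i) t0) => [||t t_gt0].
  - exact: polyfun_iter_poly_step.
  - rewrite (iter_poly_step_pair l top i) ?inE ?eqxx ?orbT// => j.
    by rewrite gradE tnth_mktuple mulf_eq0 (negPf (lambda_neq0 j))/= pnatr_eq0 eqb0 negbK.
  - rewrite grad_normalize iter_poly_stepZ => /eqP.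
    by rewrite mulf_eq0 expf_eq0 invr_eq0 (gt_eqF t_gt0) andbF/= => /eqP.
have {}alive : \forall t \ae sphere_measure R n.+1,
    forall k, iter k (poly_step l) (grad t) i != 0 by exact/ae_foralln.
apply: filterS3 (ae_coord top) (ae_coord bot) alive => t gt gb gi.
have g2 := weights_two_sided _ _ _ gt gb.
rewrite /rate (ogd_rateE lambda l top bot H c)// lee_fin.
apply: rate_of_var_le.
  by rewrite divr_gt0// subr_gt0 -real_normK ?num_real// expr_lt1.
apply: (limit_var_ge l top bot) => // k.
by rewrite -(weights_iter_poly_step _ top bot)// weights_gt0.
Qed.

(** Around a point whose gradient is supported by the two extreme indices, with
    variance [v2] between [v] and [v1], the estimate of [limit_var_le] keeps the
    limit variance below [v1]. *)
Lemma rate_upper_bound v v1 (y : \bar R) : 0 < v -> v < v1 -> v1 <= 1 ->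
    (forall i, l i ^+ 2 != 1 -> (1 - l i ^+ 2) / 2 <= v) ->
    (\forall t \ae sphere_measure R n.+1, (y <= rate t)%E) ->
  (y <= (rate_of_var v1)%:E)%E.
Proof.
move=> v_gt0 vv1 v1_le1 vmax yrate.
pose v0 := (2 * v + v1) / 3; pose v2 := (v + 2 * v1) / 3.
have v_lt0 : v < v0 by rewrite /v0; lra.
have v02 : v0 < v2 by rewrite /v0 /v2; lra.
have v21 : v2 < v1 by rewrite /v2; lra.
have v0_gt0 : 0 < v0 by exact: lt_trans v_lt0.
have [g1 g1_gt0 g1P] := exists_pos_lower_bound _ (fun i => 1 - l i ^+ 2).
pose g := Num.min (g1 / 2) (v0 - v).
have g_gt0 : 0 < g by rewrite lt_min divr_gt0// subr_gt0.
have w0 i : 0 <= 1 - l i ^+ 2.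
  by rewrite subr_ge0 -real_normK ?num_real// expr_le1.
have gap i : l i ^+ 2 = 1 \/ 2 * g <= 1 - l i ^+ 2 /\ 1 - l i ^+ 2 + 2 * g <= 2 * v0.
  have [|li] := eqVneq (l i ^+ 2) 1; [by left|right].
  have ga : g <= g1 / 2 by rewrite ge_min lexx.
  have gb : g <= v0 - v by rewrite ge_min lexx orbT.
  have wi : 0 < 1 - l i ^+ 2 by rewrite lt_neqAle w0 eq_sym subr_eq0 eq_sym li.
  have := g1P i wi; have := vmax i li; lra.
(* On the nodes 1 and -1, masses (1 + m) / 2 and (1 - m) / 2 have mean m and
   variance 1 - m ^ 2, which is v2 for this m. *)
pose m := Num.sqrt (1 - v2).
have m2 : m ^+ 2 = 1 - v2 by rewrite sqr_sqrtr// subr_ge0 ltW// (lt_le_trans v21).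
have m_lt1 : m < 1.
  rewrite -sqrtr1 /m ltr_sqrt//; have := v_gt0; have := v_lt0; have := v02; lra.
have m_ge0 : 0 <= m by exact: sqrtr_ge0.
have tb : top != bot.
  by apply/eqP => tb; move: l_bot; rewrite -tb l_top; lra.
pose z : 'cV[R]_n.+1 := \col_i (if i == top then Num.sqrt ((1 + m) / 2) / lambda 0 top
  else if i == bot then Num.sqrt ((1 - m) / 2) / lambda 0 bot else 0).
pose S := \sum_i z i 0 ^+ 2.
have S_ge0 : 0 <= S by apply: sumr_ge0 => i _; exact: sqr_ge0.
(* Scaling by s brings z into the open unit ball: S / (1 + S) ^ 2 < 1. *)
pose s := (1 + S)^-1.
have s_gt0 : 0 < s by rewrite invr_gt0 ltr_pwDl.
pose x0 := s *: z.
have gz i : gradient lambda z i = if i == top then Num.sqrt ((1 + m) / 2)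
    else if i == bot then Num.sqrt ((1 - m) / 2) else 0.
  rewrite /gradient mxE; case: eqP => [->|_]; first by rewrite mulrC divfK.
  by case: eqP => [->|_]; rewrite ?mulr0// mulrC divfK.
have gtop : gradient lambda z top ^+ 2 = (1 + m) / 2.
  by rewrite gz eqxx sqr_sqrtr// divr_ge0// addr_ge0.
have gbot : gradient lambda z bot ^+ 2 = (1 - m) / 2.
  by rewrite gz eq_sym (negPf tb) eqxx sqr_sqrtr// divr_ge0// subr_ge0 ltW.
have sum2 (f : 'I_n.+1 -> R) : \sum_i gradient lambda z i ^+ 2 * f i =
    (1 + m) / 2 * f top + (1 - m) / 2 * f bot.
  rewrite (bigD1 top)//= (bigD1 bot) 1?eq_sym//= big1 ?addr0 ?gtop ?gbot//.
  by move=> i /andP[it ib]; rewrite gz (negPf it) (negPf ib) expr0n mul0r.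
have N1 : sqr_norm (gradient lambda z) = 1.
  rewrite /sqr_norm; under eq_bigr do rewrite -[_ ^+ 2]mulr1.
  by rewrite sum2; field.
pose p (x : 'cV[R]_n.+1) := weights (gradient lambda x).
have px0 : p x0 = p z.
  rewrite /p -(weightsZ s (gradient lambda z)) ?gt_eqF//; congr weights.
  by apply/funext => i; rewrite /gradient mxE mulrCA.
have Ep f : expect (p x0) f = (1 + m) / 2 * f top + (1 - m) / 2 * f bot.
  by rewrite px0 expect_weights N1 divr1 sum2.
have mean0 : mean l (p x0) = m by rewrite /mean Ep l_top l_bot; field.
have var0 : var l (p x0) = v2.
  have -> : v2 = 1 - m ^+ 2 by rewrite m2; ring.
  by rewrite /var Ep mean0 l_top l_bot; field.
have def0 : defect l (p x0) = 0 by rewrite /defect Ep l_top l_bot; ring.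
have gx0 : sqr_norm (gradient lambda x0) != 0.
  suff -> : sqr_norm (gradient lambda x0) = s ^+ 2 by rewrite expf_neq0// gt_eqF.
  rewrite -[RHS]mulr1 -N1 /sqr_norm mulr_sumr; apply: eq_bigr => i _.
  by rewrite /gradient mxE; ring.
have px0top : 0 < p x0 top.
  by rewrite px0 /p /weights N1 divr1 gtop divr_gt0// ltr_wpDr.
have px0bot : 0 < p x0 bot.
  by rewrite px0 /p /weights N1 divr1 gbot divr_gt0// subr_gt0.
have x0_neq0 : x0 != 0.
  apply: contraNneq gx0 => x00; rewrite /sqr_norm big1// => i _.
  by rewrite /gradient x00 mxE mulr0 expr0n.
have x0_lt1 : \sum_i x0 i 0 ^+ 2 < 1.
  rewrite (_ : \sum_i _ = S / (1 + S) ^+ 2); last first.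
    rewrite /S mulr_suml; apply: eq_bigr => i _; rewrite mxE exprMn -/S /s.
    by rewrite exprVn mulrC.
  rewrite ltr_pdivrMr ?exprn_gt0 ?ltr_pwDl//; nra.
have gcont i : gradient lambda x i @[x --> x0] --> gradient lambda x0 i.
  exact: (cvgM (cvg_cst (lambda 0 i)) (@coord_continuous R _ _ i 0 x0)).
have g2cont i : gradient lambda x i ^+ 2 @[x --> x0] --> gradient lambda x0 i ^+ 2.
  by under eq_fun do rewrite expr2; rewrite expr2; exact: (cvgM (gcont i) (gcont i)).
have pcont i : p x i @[x --> x0] --> p x0 i.
  apply: (cvgM (g2cont i)); apply: cvgV => //.
  exact: (@cvg_fin_sum R _ (nbhs x0) (nbhs_filter x0) _ _ _ g2cont).
have Econt (f : 'cV[R]_n.+1 -> 'I_n.+1 -> R) : (forall i, f x i @[x --> x0] --> f x0 i) ->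
    expect (p x) (f x) @[x --> x0] --> expect (p x0) (f x0).
  move=> fc; apply: (@cvg_fin_sum R _ (nbhs x0) (nbhs_filter x0)) => i.
  exact: (cvgM (pcont i) (fc i)).
have ccont (a : R) : cst a x @[x --> x0] --> a by exact: (@cvg_cst R a _ (nbhs x0) (nbhs_filter x0)).
have mcont : mean l (p x) @[x --> x0] --> mean l (p x0).
  exact: (Econt (fun _ => l) (fun i => ccont (l i))).
have vcont : var l (p x) @[x --> x0] --> v2.
  rewrite -var0; apply: (Econt (fun x i => (l i - mean l (p x)) ^+ 2)) => i.
  under eq_fun do rewrite expr2; rewrite expr2.
  have lm : l i - mean l (p x) @[x --> x0] --> l i - mean l (p x0).
    exact: cvgB (ccont (l i)) mcont.
  exact: (cvgM lm lm).
have dcont : defect l (p x) @[x --> x0] --> 0.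
  rewrite -def0.
  exact: (Econt (fun _ i => 1 - l i ^+ 2) (fun i => ccont (1 - l i ^+ 2))).
pose K := 1 + 4 / v0.
have Kcont : K * defect l (p x) @[x --> x0] --> 0.
  by rewrite -(mulr0 K); exact: (cvgM (ccont K) dcont).
have Lcont : var l (p x) + K ^+ 2 / g * defect l (p x) @[x --> x0] --> v2.
  rewrite -[v2]addr0 -(mulr0 (K ^+ 2 / g)).
  exact: (cvgD vcont (cvgM (ccont (K ^+ 2 / g)) dcont)).
pose W := [set x | [/\ 0 < p x top, 0 < p x bot, v0 < var l (p x),
  K * defect l (p x) < g & var l (p x) + K ^+ 2 / g * defect l (p x) < v1]].
have x0W : nbhs x0 W.
  near=> x; split.
  - by near: x; exact: (cvgr_gt _ (pcont top)).
  - by near: x; exact: (cvgr_gt _ (pcont bot)).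
  - by near: x; exact: (cvgr_gt _ vcont).
  - by near: x; exact: (cvgr_lt _ Kcont).
  - by near: x; exact: (cvgr_lt _ Lcont).
have [t [t_gt0 [pt pb vt dt Lt] yt]] := sphere_ae_open _ _ _ x0_neq0 x0_lt1 x0W yrate.
apply: (le_trans yt).
have ptE : weights (gradient lambda (\col_i (tnth (normalize t) i : R))) = p (col_of_tuple t).
  rewrite -[gradient _ _]/(grad (normalize t)) grad_normalize weightsZ//.
  by rewrite invr_eq0 gt_eqF.
have p2 : two_sided top bot (p (col_of_tuple t)).
  apply: weights_two_sided; by rewrite -weights_gt0.
rewrite /rate (ogd_rateE lambda l top bot H c)// ptE// lee_fin.
apply: rate_of_var_le; first exact: (limit_var_gt0 l top bot).
apply: le_trans (ltW Lt).
by apply: (limit_var_le l top bot l_bound l_top l_bot _ p2 v0 g) => //; exact: ltW.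
Unshelve. all: by end_near. Qed.

(** The bounds match in the limit [v1 --> v] of [rate_upper_bound]: the node
    closest to [0] has the largest critical variance. *)
Lemma ess_inf_rate i : `|l i| < 1 ->
    (forall j, `|l j| < 1 -> `|l i| <= `|l j|) ->
  ess_inf (sphere_measure R n.+1) rate = (rate_of_var ((1 - l i ^+ 2) / 2))%:E.
Proof.
move=> li1 imin; set v := (1 - l i ^+ 2) / 2.
have v_gt0 : 0 < v by rewrite divr_gt0// subr_gt0 -real_normK ?num_real// expr_lt1.
have v_lt1 : v < 1 by rewrite /v; have := sqr_ge0 (l i); lra.
have vmax j : l j ^+ 2 != 1 -> (1 - l j ^+ 2) / 2 <= v.
  move=> lj; rewrite ler_pM2r// lerD2l lerN2 -real_normK ?num_real//.
  rewrite -[leRHS]real_normK ?num_real// ler_pXn2r ?nnegrE//; apply: imin.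
  rewrite lt_neqAle l_bound andbT; apply: contraNneq lj => lj1.
  by rewrite -real_normK ?num_real// lj1 expr1n.
apply/eqP; rewrite eq_le; apply/andP; split; last first.
  by apply/ess_infP; exact: rate_lower_bound.
have up w : v < w -> w <= 1 ->
    (ess_inf (sphere_measure R n.+1) rate <= (rate_of_var w)%:E)%E.
  move=> vw w1; apply: (rate_upper_bound v) => //; exact: ess_inf_le.
move: up; case: (ess_inf _ _) => [e|up|_]; last by rewrite leNye.
  move=> up; rewrite lee_fin.
  have rcont : rate_of_var w @[w --> v^'+] --> rate_of_var v.
    apply: cvg_at_right_filter; apply: (@continuous_cvg _ _ _ _ _ _ Num.sqrt); first exact: sqrt_continuous.
    apply: cvgM; first exact: cvg_id.
    apply: cvgV; first by rewrite gt_eqF// den_gt0.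
    by apply: cvgD; [exact: cvg_cst|exact: cvg_id].
  apply: (ler_cvg_to (cvg_cst e) rcont); near=> w.
  by rewrite -lee_fin; apply: up; near: w; [exact: nbhs_right_gt|exact: nbhs_right_le].
by have := up _ v_lt1 (lexx 1); rewrite leye_eq.
Unshelve. all: by end_near. Qed.

End essential_infimum.

Theorem theorem1p3 (R : realType) (n : nat) (lambda : 'rV[R]_n.+1)
    (n_gt2 : (2 < n.+1)%N)
    (lambda_sorted : forall i j : 'I_n.+1, (i <= j)%N ->
      lambda 0 j <= lambda 0 i)
    (lambda_gt0 : 0 < lambda 0 ord_max)
    (lambda_mid : exists2 i : 'I_n.+1, (0 < i < n)%N &
      lambda 0 ord_max < lambda 0 i < lambda 0 ord0) :
  let lmax := lambda 0 ord0 in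
  let lmin := lambda 0 ord_max in
  let a := lmin / lmax in
  let delta := inf [set `|lambda 0 i - (lmax + lmin) / 2| / ((lmax - lmin) / 2)
                   | i in [set i : 'I_n.+1 | lmin < lambda 0 i < lmax]] in
  let B := 4 * (1 + delta ^+ 2) / (1 - delta ^+ 2) in
  ess_inf (sphere_measure R n.+1)
    (fun t => ogd_rate (diag_mx lambda) (\col_i (tnth t i : R))) =
  ((1 - a) / Num.sqrt ((1 + a) ^+ 2 + B * a))%:E.
Proof.
move=> lmax lmin a delta B.
have [i0 _ i0mid] := lambda_mid.
have lmin_lt : lmin < lmax by case/andP: i0mid => /lt_trans; apply.
pose C := (lmax + lmin) / 2; pose H := (lmax - lmin) / 2.
have H_gt0 : 0 < H by rewrite divr_gt0// subr_gt0.
pose c := C / H; pose l (i : 'I_n.+1) := (lambda 0 i - C) / H.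
have lmax_gt0 : 0 < lmax := lt_trans lambda_gt0 lmin_lt.
have c_gt1 : 1 < c by rewrite ltr_pdivlMr// mul1r /H /C; have := lambda_gt0; rewrite -/lmin; lra.
have l_top : l ord0 = 1.
  by rewrite /l -/lmax (_ : lmax - C = H) ?divff ?gt_eqF//; rewrite /C /H; lra.
have l_bot : l ord_max = -1.
  by rewrite /l -/lmin (_ : lmin - C = - H) ?mulNr ?divff ?gt_eqF//; rewrite /C /H; lra.
have l_bound i : `|l i| <= 1.
  have h1 : lambda 0 i <= lmax by exact: lambda_sorted.
  have h2 : lmin <= lambda 0 i by apply: lambda_sorted; exact: leq_ord.
  by rewrite ler_norml ler_pdivlMr// ler_pdivrMr//; apply/andP; split; rewrite /C /H; lra.
have midE i : (`|l i| < 1) = (lmin < lambda 0 i < lmax).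
  rewrite ltr_norml ltr_pdivlMr// ltr_pdivrMr//; congr andb;
  by apply/idP/idP; rewrite /C /H; lra.
have lambdaE i : lambda 0 i = H * (c + l i) by rewrite /c /l; field; rewrite gt_eqF.
have i0mid' : `|l i0| < 1 by rewrite midE.
have [i imid imin] := @Order.TotalTheory.arg_minP _ R _ i0 (fun i => `|l i| < 1)
  (fun i => `|l i|) i0mid'.
have normlE j : `|lambda 0 j - (lmax + lmin) / 2| / ((lmax - lmin) / 2) = `|l j|.
  by rewrite /l normrM normfV -/C -/H (gtr0_norm H_gt0).
have deltaE : delta = `|l i|.
  apply/eqP; rewrite eq_le; apply/andP; split.
    apply: ge_inf; first by exists 0 => _ [j _ <-]; rewrite normlE.
    by exists i; rewrite ?normlE//= -midE.
  apply: lb_le_inf; first by exists `|l i|, i; rewrite ?normlE//= -midE.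
  by move=> _ [j /= jmid <-]; rewrite normlE imin// midE.
rewrite (ess_inf_rate lambda l ord0 ord_max H c _ _ _ _ _ _ i)//.
congr (_%:E); rewrite /rate_of_var /B deltaE real_normK ?num_real//.
have d1 : 0 < 1 - l i ^+ 2 by rewrite subr_gt0 -real_normK ?num_real// expr_lt1.
set d := l i ^+ 2 in d1 *; have d0 : 0 <= d by exact: sqr_ge0.
have a_gt0 : 0 < a by rewrite divr_gt0.
have a_lt1 : a < 1 by rewrite ltr_pdivrMr// mul1r.
have cE : c = (1 + a) / (1 - a).
  rewrite /c /C /H /a; field; rewrite !gt_eqF ?subr_gt0//.
have D_gt0 : 0 < (1 + a) ^+ 2 + 4 * (1 + d) / (1 - d) * a.
  rewrite ltr_pwDl//; first by rewrite exprn_gt0// addr_gt0.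
  by rewrite mulr_ge0 ?(ltW a_gt0)// divr_ge0 ?(ltW d1)// mulr_ge0// addr_ge0.
have a1 : 0 <= 1 - a by rewrite subr_ge0 ltW.
rewrite -[in RHS](ger0_norm a1) -sqrtr_sqr -sqrtrV ?(ltW D_gt0)// -sqrtrM ?sqr_ge0//.
congr Num.sqrt; rewrite cE; field.
have D1 : 0 < (1 + a) ^+ 2 * (1 - d) + 4 * (1 + d) * a.
  suff -> : (1 + a) ^+ 2 * (1 - d) + 4 * (1 + d) * a =
      ((1 + a) ^+ 2 + 4 * (1 + d) / (1 - d) * a) * (1 - d) by exact: mulr_gt0.
  by field; rewrite gt_eqF.
by rewrite (gt_eqF D1) (gt_eqF d1) gt_eqF// subr_gt0.
Qed.
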